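(* Let $\bar u\in U_{ad}$ be a local minimizer of $(P_\kappa)$, $\bar y:=S(\bar u)$, and let $\bar p\in H^1_0(\Omega)\cap C(\overline\Omega)$, $\bar\lambda\in\partial j(\bar u)$, $\chi\in L^\infty(\Omega)$ satisfy $A^*\bar p+\chi\bar p=\frac{\partial L}{\partial y}(x,\bar y)$ in $\Omega$, $\bar p=0$ on $\partial\Omega$; $\chi(x)\in\partial_Cf(\bar y(x))$ for a.a. $x\in\Omega$; and $\int_\Omega(\bar p+\nu\bar u+\kappa\bar\lambda)(u-\bar u)\,dx\ge0$ for all $u\in U_{ad}$. Then for a.a. $x\in\Omega$ the following relations hold: $$\bar u(x)=\mathrm{proj}_{[\alpha,\beta]}\Big(-\tfrac1\nu(\bar p(x)+\kappa\bar\lambda(x))\Big),$$ $$\bar u(x)=0\iff|\bar p(x)|\le\kappa,$$ $$\bar\lambda(x)=\mathrm{proj}_{[-1,+1]}\Big(-\tfrac1\kappa\bar p(x)\Big)\quad\text{whenever }\kappa>0.$$ Moreover, if $\lambda^N(\{\bar y\in E_f\})=0$, then the adjoint state $\bar p$ and the multiplier $\bar\lambda$ are uniquely determined for any local minimizer $\bar u$.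
   Context: Setting. $\Omega\subset\mathbb R^N$, $N\ge1$, is a bounded domain with Lipschitz boundary; $\lambda^N$ is Lebesgue measure; $\nu>0$, $\kappa\ge0$, $-\infty<\alpha<0<\beta<\infty$. $\mathbf 1_M$ is the characteristic function of $M$; $\{g\in M\}:=\{x: g(x)\in M\}$; $\mathrm{proj}_{[a,b]}(t)=\min\{b,\max\{a,t\}\}$. $Ay=-\sum_{i,j=1}^N\partial_j(a_{ij}\partial_i y)+a_0y$ with $a_{ij},a_0\in L^\infty(\Omega)$, $a_0\ge0$ a.e., and $\sum_{i,j}a_{ij}(x)\xi_i\xi_j\ge\Lambda|\xi|^2$ for a.a. $x$, all $\xi\in\mathbb R^N$, some $\Lambda>0$. $A^*p=-\sum_{i,j}\partial_i(a_{ij}\partial_j p)+a_0p$. Boundary value problems are understood in the weak sense. $f:\mathbb R\to\mathbb R$ is continuous, $f(t)=\sum_{i=0}^K\mathbf 1_{(\tau_i,\tau_{i+1}]}(t)f_i(t)$ with $-\infty=\tau_0<\tau_1<\dots<\tau_K<\tau_{K+1}=\infty$ (convention $(t,+\infty]:=(t,\infty)$), $f_i\in C^2(\mathbb R)$ monotonically increasing, $f_{i-1}(\tau_i)=f_i(\tau_i)$ and $f_{i-1}'(\tau_i)\neq f_i'(\tau_i)$ for $1\le i\le K$. $E_f:=\{\tau_1,\dots,\tau_K\}$. $\partial_Cf$ is the Clarke subdifferential. Fix $\bar r>N/2$ with $\bar r\ge2$. For $u\in L^{\bar r}(\Omega)$, $y_u=S(u)\in H^1_0(\Omega)\cap C(\overline\Omega)$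 denotes the unique weak solution of $Ay+f(y)=u$ in $\Omega$, $y=0$ on $\partial\Omega$. $L:\Omega\times\mathbb R\to\mathbb R$ is Carathéodory, $C^2$ in the second variable, $L(\cdot,0)\in L^1(\Omega)$, and for every $M>0$ there are $\phi_M\in L^2(\Omega)$, $\psi_M\in L^1(\Omega)$ with $|\partial_yL(x,y)|\le\phi_M(x)$, $|\partial_y^2L(x,y)|\le\psi_M(x)$, $|\partial^2_yL(x,y_1)-\partial_y^2L(x,y_2)|\le\psi_M(x)|y_1-y_2|$ for a.a. $x$ and all $|y|,|y_1|,|y_2|\le M$. $F(u)=\int_\Omega L(x,y_u(x))\,dx+\frac\nu2\int_\Omega u^2\,dx$, $j(u)=\int_\Omega|u|\,dx$, $J_\kappa=F+\kappa j$, $U_{ad}=\{u\in L^\infty(\Omega):\alpha\le u\le\beta\text{ a.e.}\}$. Problem $(P_\kappa)$: minimize $J_\kappa(u)$ over $u\in U_{ad}$. A local minimizer is a $\bar u\in U_{ad}$ such that for some $\rho>0$, $J_\kappa(\bar u)\le J_\kappa(u)$ for all $u\in U_{ad}$ with $\|u-\bar u\|_{L^2(\Omega)}\le\rho$. $\partial j(u)$ is the convex subdifferential of $j$ on $L^1(\Omega)$: $\lambda\in\partial j(u)$ iff $\lambda=1$ a.e. on $\{u>0\}$, $\lambda=-1$ a.e. on $\{u<0\}$, $\lambda\in[-1,1]$ a.e. on $\{u=0\}$.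
   Formalization: Uniqueness of the multiplier $\bar\lambda$ is stated only for $\kappa>0$; for $\kappa=0$ it fails (e.g. $L=0$, $\bar u=0$, $\bar p=0$, any $|\bar\lambda|\le1$). Uniqueness of $\bar p$ is stated for all $\kappa\ge0$. *)

(* Defs.v *)
From HB Require Import structures.
From mathcomp Require Import all_boot all_order all_algebra.
From mathcomp Require Import all_classical all_reals all_analysis.

Set Implicit Arguments.
Unset Strict Implicit.
Unset Printing Implicit Defensive.

Import Order.TTheory GRing.Theory Num.Theory.
Import numFieldNormedType.Exports.

Local Open Scope classical_set_scope.
Local Open Scope ring_scope.

(* 'rV[R]_n carries the product sigma-algebra generated by the coordinates,
   i.e. the Borel sigma-algebra of R^n (as n.-tuple R in the library). *)
Section measurable_rV.
Context {R : realType} (n : nat).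

Let coors (i : 'I_n) (x : 'rV[R]_n) : R := x ord0 i.

Let rV_set0 : g_sigma_preimage coors set0.
Proof. exact: sigma_algebra0. Qed.

Let rV_setC A : g_sigma_preimage coors A -> g_sigma_preimage coors (~` A).
Proof. exact: sigma_algebraC. Qed.

Let rV_bigcup (F : (set 'rV[R]_n)^nat) :
  (forall i, g_sigma_preimage coors (F i)) ->
  g_sigma_preimage coors (\bigcup_i F i).
Proof. exact: sigma_algebra_bigcup. Qed.

HB.instance Definition _ := @isMeasurable.Build
  (measure_tuple_display default_measure_display)
  'rV[R]_n (g_sigma_preimage coors) rV_set0 rV_setC rV_bigcup.

Lemma measurable_coor (i : 'I_n) :
  measurable_fun [set: 'rV[R]_n] (fun x : 'rV[R]_n => x ord0 i).
Proof.
move=> _ Y mY; rewrite setTI; apply: sub_sigma_algebra => /=.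
rewrite -bigcup_seq/=; exists i => /=; first by rewrite mem_index_enum.
by exists Y => //; rewrite setTI.
Qed.

Lemma measurable_fun_rV d (T : measurableType d) (f : T -> 'rV[R]_n) :
  (forall i, measurable_fun [set: T] (fun x => f x ord0 i)) ->
  measurable_fun [set: T] f.
Proof.
move=> mf _ A mA; rewrite setTI; move: A mA.
suff : g_sigma_preimage (fun i => coors i \o f) `<=` measurable.
  rewrite g_sigma_preimage_comp => H A mA.
  by apply: H; exists A => //; rewrite setTI.
apply: smallest_sub; first exact: sigma_algebra_measurable.
rewrite -bigcup_seq => A [i _ [B mB <-]]; exact: mf.
Qed.

End measurable_rV.

Section lebesgue_rV.
Context {R : realType}.

Definition cons_rV (n : nat) (vx : 'rV[R]_n * measurableTypeR R) : 'rV[R]_n.+1 :=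
  row_mx (vx.2)%:M vx.1.

Lemma measurable_cons_rV n : measurable_fun setT (@cons_rV n).
Proof.
apply: measurable_fun_rV => i; case: (@split_ordP 1 n i) => j ->.
- rewrite (_ : (fun _ => _) = snd) //; apply/funext => x.
  by rewrite /cons_rV (row_mxEl x.2%:M x.1) !ord1 mxE eqxx mulr1n.
- rewrite (_ : (fun _ => _) = (fun v : 'rV[R]_n => v ord0 j) \o fst).
    exact: measurableT_comp (measurable_coor j) measurable_fst.
  by apply/funext => x; rewrite /cons_rV (row_mxEr x.2%:M x.1).
Qed.


Definition extend_measure n (mu : {measure set 'rV[R]_n -> \bar R}) :
    {measure set 'rV[R]_n.+1 -> \bar R} :=
  measure_function_pushforward__canonical__measure_function_Measure
    (mu \x @lebesgue_measure R)%E (@measurable_cons_rV n).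

(* n-dimensional Lebesgue measure (on Borel sets), as the iterated product of
   the one-dimensional one. *)
Fixpoint lebesgue_rV (n : nat) : {measure set 'rV[R]_n -> \bar R} :=
  if n is m.+1 then extend_measure (lebesgue_rV m)
  else \d_(0 : 'rV[R]_0).

Lemma lebesgue_rVS n (A : set 'rV[R]_n.+1) :
  lebesgue_rV n.+1 A =
  (lebesgue_rV n \x @lebesgue_measure R)%E (@cons_rV n @^-1` A).
Proof. by []. Qed.

Lemma lebesgue_rV_box n (A : 'I_n -> set R) :
  (forall i, measurable (A i)) ->
  lebesgue_rV n [set x | forall i, A i (x ord0 i)] =
  (\prod_(i < n) @lebesgue_measure R (A i))%E.
Proof.
elim: n A => [|n IHn] A mA.
  by rewrite big_ord0 /= diracE mem_set //= => -[].
rewrite lebesgue_rVS (_ : _ @^-1` _ =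
  [set v : 'rV[R]_n | forall i, A (lift ord0 i) (v ord0 i)] `*` A ord0).
  rewrite product_measure1E; [|..|exact: mA]; last first.
    rewrite (_ : [set _ | _] = \bigcap_(i in [set: 'I_n])
      ((fun v : 'rV[R]_n => v ord0 i) @^-1` A (lift ord0 i))).
      apply: fin_bigcap_measurable => // i _.
      by rewrite -[X in measurable X]setTI; exact: measurable_coor.
    by apply/seteqP; split => v /= H i; [move=> _|]; exact: H.
  by rewrite big_ord_recl muleC; congr (_ * _)%E; exact: IHn.
have E0 v x : @cons_rV n (v, x) ord0 ord0 = x.
  transitivity ((x%:M : 'M[R]_1) ord0 ord0); last by rewrite mxE eqxx mulr1n.
  rewrite -(row_mxEl x%:M v ord0 ord0).
  by congr (row_mx _ _ _ _); exact/val_inj.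
have E1 v x i : @cons_rV n (v, x) ord0 (lift ord0 i) = v ord0 i.
  rewrite -(row_mxEr x%:M v ord0 i).
  by congr (row_mx _ _ _ _); exact/val_inj.
apply/seteqP; split => [[v x] /= H|[v x] /= [Hv Hx] i].
  by split=> [i|]; [rewrite -(E1 v x)|rewrite -(E0 v x)]; exact: H.
by case: (unliftP ord0 i) => [j|] ->; rewrite ?E1 ?E0.
Qed.

End lebesgue_rV.

Section function_spaces.
Context {R : realType} {n : nat}.
Local Notation E := 'rV[R]_n.
Local Notation leb := (@lebesgue_rV R n).
Implicit Types (Omega : set E) (y phi : E -> R).

(* f belongs to L^p(Omega); values of f outside Omega are irrelevant *)
Definition Lp Omega (p : \bar R) (f : E -> R) : Prop :=
  (f \_ Omega) \in Lfun leb p.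

Definition L2norm Omega (f : E -> R) : \bar R :=
  'N[leb]_2%:E[EFin \o (f \_ Omega)]%E.

Definition partial (i : 'I_n) phi : E -> R := fun x => 'D_(delta_mx ord0 i) phi x.

Fixpoint Ck (k : nat) phi : Prop :=
  continuous phi /\
  if k is k'.+1 then
    forall i, (forall x, derivable phi x (delta_mx ord0 i)) /\ Ck k' (partial i phi)
  else True.

Definition support_closure phi : set E := closure [set x | phi x != 0].

(* C_c^infty(Omega) *)
Definition test_function Omega phi : Prop :=
  [/\ forall k, Ck k phi,
      compact (support_closure phi) &
      support_closure phi `<=` Omega].

(* y belongs to H^1(Omega) and dy is its weak gradient *)
Definition in_H1 Omega y (dy : 'I_n -> E -> R) : Prop :=
  [/\ Lp Omega 2%:E y,
      forall i, Lp Omega 2%:E (dy i) &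
      forall i phi, test_function Omega phi ->
        (\int[leb]_(x in Omega) (y x * partial i phi x)) =
        - (\int[leb]_(x in Omega) (dy i x * phi x))].

(* y belongs to H^1_0(Omega), the closure of C_c^infty(Omega) in H^1(Omega),
   and dy is its weak gradient *)
Definition in_H10 Omega y (dy : 'I_n -> E -> R) : Prop :=
  in_H1 Omega y dy /\
  exists phi_ : nat -> E -> R,
    [/\ forall k, test_function Omega (phi_ k),
        L2norm Omega (phi_ k \- y) @[k --> \oo] --> 0%E &
        forall i, L2norm Omega (partial i (phi_ k) \- dy i) @[k --> \oo] --> 0%E].

(* weak solution y in H^1_0(Omega) of
     - sum_(i,j) d_j (a_ij d_i y) + a0 y + c = g  in Omega,
     y = 0 on the boundary of Omega *)
Definition weak_solution Omega (a : 'I_n -> 'I_n -> E -> R) (a0 c g : E -> R) y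
    : Prop :=
  exists2 dy, in_H10 Omega y dy &
    forall v dv, in_H10 Omega v dv ->
      (\int[leb]_(x in Omega)
        ((\sum_(i < n) \sum_(j < n) a i j x * dy i x * dv j x)
         + a0 x * y x * v x + c x * v x)) =
      (\int[leb]_(x in Omega) (g x * v x)).

Definition elliptic_coefficients Omega (a : 'I_n -> 'I_n -> E -> R) (a0 : E -> R)
    : Prop :=
  [/\ forall i j, Lp Omega +oo%E (a i j),
      Lp Omega +oo%E a0,
      \forall x \ae leb, Omega x -> 0 <= a0 x &
      exists2 Lambda : R, 0 < Lambda &
        \forall x \ae leb, Omega x -> forall xi : E,
          Lambda * \sum_(i < n) (xi ord0 i) ^+ 2 <=
          \sum_(i < n) \sum_(j < n) a i j x * xi ord0 i * xi ord0 j].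

End function_spaces.

(* Near each boundary point, Omega is, up to a change of orthonormal
   coordinates, the strict epigraph of a Lipschitz function of the last n
   coordinates. *)
Definition lipschitz_boundary {R : realType} {n : nat} (Omega : set 'rV[R]_n.+1)
    : Prop :=
  forall x0, (closure Omega `\` Omega°) x0 ->
  exists (Q : 'M[R]_n.+1) (r : R) (g : 'rV[R]_n -> R),
    [/\ Q *m Q^T = 1%:M, 0 < r, lipschitz g &
        forall x, ball x0 r x ->
          (Omega x <-> g (col' ord0 (x *m Q)) < (x *m Q) ord0 ord0)].

Definition bounded_lipschitz_domain {R : realType} {n : nat}
    (Omega : set 'rV[R]_n.+1) : Prop :=
  [/\ open Omega, connected Omega, Omega !=set0, bounded_set Omega &
      lipschitz_boundary Omega].

Section nonlinearities.
Context {R : realType}.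

Definition C2 (g : R -> R) : Prop :=
  [/\ forall t, derivable g t 1, forall t, derivable (derive1 g) t 1 &
      continuous (derive1n 2 g)].

(* Clarke's generalized directional derivative of f at t in direction h *)
Definition clarke_dir_derivative (f : R -> R) (t h : R) : \bar R :=
  limf_esup (fun sl : R * R => ((f (sl.1 + sl.2 * h) - f sl.1) / sl.2)%:E)
            (filter_prod (nbhs t) (0^'+)).

Definition clarke_subdifferential (f : R -> R) (t : R) : set R :=
  [set xi | forall h, ((xi * h)%:E <= clarke_dir_derivative f t h)%E].

(* tau 0 = -oo < tau 1 < ... < tau K < tau K.+1 = +oo; only the indices
   i <= K.+1 of tau and i <= K of f_ are used *)
Definition piecewise_C2 (K : nat) (tau : nat -> \bar R) (f_ : nat -> R -> R)
    (f : R -> R) : Prop :=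
  [/\ continuous f,
      [/\ tau 0%N = -oo%E, tau K.+1 = +oo%E &
          forall i, (i <= K)%N -> (tau i < tau i.+1)%E],
      forall t, f t =
        \sum_(i < K.+1) \1_[set s : R | (tau i < s%:E <= tau i.+1)%E] t * f_ i t,
      forall i, (i <= K)%N -> C2 (f_ i) /\ {homo f_ i : s t / s <= t} &
      forall i, (1 <= i <= K)%N ->
        f_ i.-1 (fine (tau i)) = f_ i (fine (tau i)) /\
        derive1 (f_ i.-1) (fine (tau i)) <> derive1 (f_ i) (fine (tau i))].

Definition kinks (K : nat) (tau : nat -> \bar R) : set R :=
  [set fine (tau i) | i in [set i | (1 <= i <= K)%N]].

Definition proj_itv (a b t : R) : R := Num.min b (Num.max a t).

End nonlinearities.

Section control_problem.
Context {R : realType} {n : nat}.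
Local Notation E := 'rV[R]_n.
Local Notation leb := (@lebesgue_rV R n).
Variables (Omega : set E) (a : 'I_n -> 'I_n -> E -> R) (a0 : E -> R) (f : R -> R).
Implicit Types (u y p lam chi : E -> R) (L : E -> R -> R).

Definition admissible_integrand L : Prop :=
  [/\ forall t, measurable_fun Omega (L ^~ t),
      \forall x \ae leb, Omega x -> C2 (L x),
      Lp Omega 1%:E (L ^~ 0) &
      forall M : R, 0 < M -> exists phi psi : E -> R,
        [/\ Lp Omega 2%:E phi, Lp Omega 1%:E psi &
            \forall x \ae leb, Omega x ->
              [/\ forall t, `|t| <= M -> `|derive1 (L x) t| <= phi x,
                  forall t, `|t| <= M -> `|derive1n 2 (L x) t| <= psi x &
                  forall t1 t2, `|t1| <= M -> `|t2| <= M ->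
                    `|derive1n 2 (L x) t1 - derive1n 2 (L x) t2|
                      <= psi x * `|t1 - t2|]]].

(* y in H^1_0(Omega) and C(closure of Omega) is a weak solution of
   A y + f(y) = u, with u in L^r(Omega) *)
Definition is_state (r : R) u y : Prop :=
  [/\ Lp Omega r%:E u, {within closure Omega, continuous y} &
      weak_solution Omega a a0 (f \o y) u y].

(* The unique solution y of is_state r u y; it is unique on the closure of
   Omega, only its irrelevant values elsewhere depend on the choice. *)
Definition control_to_state (r : R) u : E -> R :=
  xget (cst 0) [set y | is_state r u y].

Definition Uad (alpha beta : R) : set (E -> R) :=
  [set u | Lp Omega +oo%E u /\
           \forall x \ae leb, Omega x -> alpha <= u x <= beta].

Definition l1_cost u : R := \int[leb]_(x in Omega) `|u x|.

Definition smooth_cost (r nu : R) L u : R :=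
  (\int[leb]_(x in Omega) L x (control_to_state r u x))
  + nu / 2 * (\int[leb]_(x in Omega) (u x) ^+ 2).

Definition cost (r nu kappa : R) L u : R := smooth_cost r nu L u + kappa * l1_cost u.

Definition local_minimizer (r nu kappa alpha beta : R) L u : Prop :=
  Uad alpha beta u /\
  exists2 rho : R, 0 < rho &
    forall v, Uad alpha beta v -> (L2norm Omega (v \- u)%R <= rho%:E)%E ->
      cost r nu kappa L u <= cost r nu kappa L v.

(* convex subdifferential of l1_cost on L^1(Omega), in the dual L^infty(Omega) *)
Definition subdiff_l1_cost u : set (E -> R) :=
  [set lam | Lp Omega +oo%E lam /\
     forall v, Lp Omega 1%:E v ->
       l1_cost u + (\int[leb]_(x in Omega) (lam x * (v x - u x))) <= l1_cost v].

(* The first-order system satisfied by (p, lam, chi) at the control u. The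
   coefficients of the adjoint operator are the transposed ones. *)
Definition first_order_system (r nu kappa alpha beta : R) L u p lam chi : Prop :=
  [/\ {within closure Omega, continuous p} /\
      weak_solution Omega (fun i k => a k i) a0 (chi \* p)
        (fun x => derive1 (L x) (control_to_state r u x)) p,
      subdiff_l1_cost u lam,
      Lp Omega +oo%E chi,
      \forall x \ae leb, Omega x ->
        clarke_subdifferential f (control_to_state r u x) (chi x) &
      forall v, Uad alpha beta v ->
        0 <= \int[leb]_(x in Omega)
               ((p x + nu * u x + kappa * lam x) * (v x - u x))].

End control_problem.

(* Main.v *)
(* The pointwise relations are obtained by testing the variational inequality
   and the subgradient inequality of the L^1 norm with controls that equal a
   rational constant on a measurable set and [u] elsewhere.

   For uniqueness, off the kinks of [f] the Clarke subdifferential reduces to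
   the nonnegative derivative of [f], so both adjoint equations have the same
   coefficients. Testing each of them with [p1] and with [p2] shows that the
   coercive form vanishes at [q = p1 - p2], hence [q] has zero gradient. Testing
   the weak derivative of [q] with [x_0 * phi_k], where the test functions
   [phi_k] converge to [q] in H^1, yields [int q^2 = 0] without Poincare's
   inequality; continuity extends [q = 0] to the closure. *)

Require Import Defs.
From mathcomp Require Import all_boot all_order all_algebra.
From mathcomp Require Import all_classical all_reals all_analysis.
From mathcomp Require Import measurable_realfun ess_sup_inf.
From mathcomp Require Import ring lra.
Import Order.TTheory GRing.Theory Num.Theory.
Import numFieldNormedType.Exports.
Local Open Scope classical_set_scope.
Local Open Scope ring_scope.

Set Implicit Arguments.
Unset Strict Implicit.
Unset Printing Implicit Defensive.

(** * Square integrable functions on a set *)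

Section square_integrable_on_set.
Context {d : measure_display} {T : measurableType d} {R : realType}.
Variables (mu : {measure set T -> \bar R}) (D : set T).
Hypothesis mD : measurable D.
Implicit Types f g h : T -> R.

Lemma Lfun_restrict_measurable p f :
  (f \_ D) \in Lfun mu p -> measurable_fun D f.
Proof.
by move=> /sub_Lfun_mfun; rewrite inE => mf; exact/(measurable_restrictT f mD).
Qed.

Lemma Lfun1_restrictP f :
  (f \_ D) \in Lfun mu 1%:E <-> mu.-integrable D (EFin \o f).
Proof.
by rewrite Lfun1_integrable -restrict_EFin; split; apply integrable_mkcond.
Qed.

(** Trades the norm of the restriction for square integrability on [D], the form in which sums and
    products are handled below. *)
Lemma Lfun2_restrictP f : (f \_ D) \in Lfun mu 2%:E <->
  measurable_fun D f /\ mu.-integrable D (EFin \o (fun x => f x ^+ 2)).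
Proof.
have sqE : EFin \o (fun x => (f \_ D) x ^+ 2) =
    (EFin \o (fun x => f x ^+ 2)) \_ D.
  apply/funext => x; rewrite restrict_EFin /= !patchE; case: ifPn => // _.
  (* Off [D] the restriction takes the default value [point] of [R], which is 0. *)
  by rewrite -[point]/(0 : R) expr0n.
split=> [f2|[mf]].
  split; first exact: Lfun_restrict_measurable f2.
  apply/integrable_mkcond => //.
  by rewrite -sqE; exact: Lfun2_integrable_sqr.
move/(integrable_mkcond _ mD); rewrite -sqE => /integrableP[_ foo].
rewrite inE; apply/andP; split; rewrite inE/=.
  exact/(measurable_restrictT f mD).
rewrite /finite_norm unlock; apply: poweR_lty; apply: le_lt_trans foo.
apply: ge0_le_integral => //=.
- apply/measurable_EFinP.
  apply/(@measurableT_comp _ _ _ _ _ _ (fun x : R => x `^ 2)) => //.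
  apply: measurableT_comp => //; exact/(measurable_restrictT f mD).
- apply/measurable_EFinP; apply: measurableT_comp => //.
  apply: measurable_funX; exact/(measurable_restrictT f mD).
- by move=> x _; rewrite lee_fin powR_mulrn// -normrX.
Qed.

Lemma Lfuny_restrict_bounded f : (f \_ D) \in Lfun mu +oo%E ->
  exists2 M : R, 0 <= M & \forall x \ae mu, D x -> `|f x| <= M.
Proof.
rewrite inE => /andP[_]; rewrite inE/= /finite_norm unlock.
(* The norm is the essential supremum only when the whole space has positive measure; otherwise
   every property holds almost everywhere. *)
case: ifPn => [mu0|]; last first.
  rewrite -leNgt measure_le0 => /eqP mu0 _; exists 0 => //.
  by exists setT; split.
set s := ess_sup _ _ => soo.
have s0 : (0 <= s)%E by apply: ess_sup_gee => //; apply: nearW => x /=.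
exists (fine s); first exact: fine_ge0.
have : \forall x \ae mu, (`|(f \_ D) x|%:E <= s)%E.
  by apply: filterS (ess_sup_ge mu (abse \o (EFin \o f \_ D))) => x.
apply: filterS => x /[swap] Dx.
by rewrite patchE mem_set//= -lee_fin fineK// ge0_fin_numE.
Qed.

Lemma Lfuny_restrict f (M : R) : measurable_fun D f ->
  (\forall x \ae mu, D x -> `|f x| <= M) -> (f \_ D) \in Lfun mu +oo%E.
Proof.
move=> mf fM; rewrite inE; apply/andP; split; rewrite inE/=.
  exact/(measurable_restrictT f mD).
rewrite /finite_norm unlock; case: ifPn => // _.
apply: (@le_lt_trans _ _ (Num.max M 0)%:E); last exact: ltry.
apply/ess_supP; apply: filterS fM => x /= fM.
rewrite lee_fin le_max patchE; case: ifPn => [/set_mem/fM ->//|_].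
by rewrite -[point]/(0 : R) normr0 lexx orbT.
Qed.

Lemma ae_le_integrable f g : measurable_fun D f ->
  (\forall x \ae mu, D x -> `|f x| <= `|g x|) ->
  mu.-integrable D (EFin \o g) -> mu.-integrable D (EFin \o f).
Proof.
move=> mf fg ig; have mg : measurable_fun D g.
  by apply/measurable_EFinP; exact: measurable_int ig.
(* [h] is dominated by [g] at every point of [D] and equals [|f|] almost everywhere, which reduces
   the claim to pointwise domination. *)
pose h x := Num.min `|f x| `|g x|.
have mh : measurable_fun D h.
  by apply: measurable_minr; exact: measurableT_comp.
have : mu.-integrable D (EFin \o h).
  apply: (le_integrable mD _ _ ig) => [|x Dx /=]; first exact/measurable_EFinP.
  by rewrite lee_fin ger0_norm ?ge_min ?lexx ?orbT// le_min !normr_ge0.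
move=> /integrableP[_ hoo]; apply/integrableP.
split; first exact/measurable_EFinP.
apply: le_lt_trans hoo; rewrite le_eqVlt; apply/orP; left; apply/eqP.
apply: ae_eq_integral => //.
- by apply: measurableT_comp => //; exact/measurable_EFinP.
- by apply: measurableT_comp => //; exact/measurable_EFinP.
apply: filterS fg => x fg Dx /=.
have /min_idPl hx := fg Dx.
by rewrite /h hx normr_id.
Qed.

Lemma Lfun2_restrictM f g :
  (f \_ D) \in Lfun mu 2%:E -> (g \_ D) \in Lfun mu 2%:E ->
  mu.-integrable D (EFin \o (fun x => f x * g x)).
Proof.
move=> f2 g2; apply/Lfun1_restrictP.
rewrite (_ : _ \_ D = (f \_ D) \* (g \_ D)); first exact: Lfun2_mul_Lfun1.
apply/funext => x /=; rewrite !patchE; case: ifPn => // _.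
by rewrite -[point]/(0 : R) mul0r.
Qed.

Lemma Lfuny_Lfun2_restrictM f g :
  (f \_ D) \in Lfun mu +oo%E -> (g \_ D) \in Lfun mu 2%:E ->
  ((fun x => f x * g x) \_ D) \in Lfun mu 2%:E.
Proof.
move=> fy /Lfun2_restrictP[mg ig]; have mf := Lfun_restrict_measurable fy.
have [M M0 fM] := Lfuny_restrict_bounded fy.
apply/Lfun2_restrictP; split; first exact: measurable_funM.
apply: (@ae_le_integrable _ (fun x => M ^+ 2 * g x ^+ 2)).
- apply: measurable_funX; exact: measurable_funM.
- apply: filterS fM => x + Dx => /(_ Dx) fM.
  rewrite -[X in _ <= `|X|]exprMn !normrX lerXn2r ?nnegrE// !normrM.
  by rewrite (ger0_norm M0) ler_wpM2r.
- rewrite (_ : _ \o _ = fun x => ((M ^+ 2)%:E * (g x ^+ 2)%:E)%E) //.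
  exact: integrableZl ig.
Qed.

Lemma Lfun2_restrictD f g :
  (f \_ D) \in Lfun mu 2%:E -> (g \_ D) \in Lfun mu 2%:E ->
  ((fun x => f x + g x) \_ D) \in Lfun mu 2%:E.
Proof.
move=> f2 g2; have ifg := Lfun2_restrictM f2 g2.
move/Lfun2_restrictP : f2 => [mf if2]; move/Lfun2_restrictP : g2 => [mg ig2].
apply/Lfun2_restrictP; split; first exact: measurable_funD.
rewrite (_ : _ \o _ = (EFin \o (fun x => f x ^+ 2)) \+
    ((EFin \o (fun x => g x ^+ 2)) \+
     ((EFin \o (fun x => f x * g x)) \+ (EFin \o (fun x => f x * g x))))).
  by apply: integrableD => //; apply: integrableD => //; exact: integrableD.
by apply/funext => x /=; rewrite -!EFinD; congr EFin; ring.
Qed.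

Lemma Lfun2_restrictZ (c : R) f :
  (f \_ D) \in Lfun mu 2%:E -> ((fun x => c * f x) \_ D) \in Lfun mu 2%:E.
Proof.
move=> /Lfun2_restrictP[mf if2].
apply/Lfun2_restrictP; split; first exact: measurable_funM.
rewrite (_ : _ \o _ = fun x => ((c ^+ 2)%:E * (f x ^+ 2)%:E)%E).
  exact: integrableZl if2.
by apply/funext => x /=; rewrite exprMn.
Qed.

Lemma Lfun2_restrictB f g :
  (f \_ D) \in Lfun mu 2%:E -> (g \_ D) \in Lfun mu 2%:E ->
  ((fun x => f x - g x) \_ D) \in Lfun mu 2%:E.
Proof.
move=> f2 g2; have -> : (fun x => f x - g x) = (fun x => f x + -1 * g x).
  by apply/funext => x; rewrite mulN1r.
exact: Lfun2_restrictD f2 (Lfun2_restrictZ (-1) g2).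
Qed.

Lemma Lfuny_Lfun2_restrict f : (mu D < +oo)%E ->
  (f \_ D) \in Lfun mu +oo%E -> (f \_ D) \in Lfun mu 2%:E.
Proof.
move=> Doo fy; have -> : f = (fun x => f x * cst 1 x).
  by apply/funext => x; rewrite mulr1.
apply: Lfuny_Lfun2_restrictM => //.
apply/Lfun2_restrictP; split; first exact: measurable_cst.
apply: measurable_bounded_integrable => //.
  by apply: measurable_funX; exact: measurable_cst.
exists 1; split; first exact: num_real.
by move=> x x1 y _ /=; rewrite expr1n normr1 ltW.
Qed.

(** On the set [B] where [f] is positive, the hypothesis forces the integral of [|f|] to vanish;
    then [f] is zero almost everywhere on [B], so [B] is negligible. *)
Lemma ae_le0_Rintegral f : mu.-integrable D (EFin \o f) ->
  (forall B, measurable B -> B `<=` D -> \int[mu]_(x in B) f x <= 0) ->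
  \forall x \ae mu, D x -> f x <= 0.
Proof.
move=> intf fle; have mf : measurable_fun D f.
  by apply/measurable_EFinP; exact: measurable_int intf.
pose B := D `&` f @^-1` `]0, +oo[.
have mB : measurable B by exact: mf.
have BD : B `<=` D by move=> x [].
have f0 x : B x -> 0 < f x by move=> [_] /=; rewrite in_itv/= andbT.
have iB : mu.-integrable B (EFin \o f) by exact: integrableS intf.
have mfB : measurable_fun B (EFin \o f) := measurable_int mu iB.
have : (\int[mu]_(x in B) `|(EFin \o f) x|)%E = 0%E.
  transitivity (\int[mu]_(x in B) (f x)%:E)%E.
    by apply: eq_integral => x /set_mem/f0 fx; rewrite /= gtr0_norm.
  rewrite -(fineK (integrable_fin_num mB iB)); congr EFin; apply/eqP.
  rewrite eq_le (fle B mB BD)/=.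
  by apply: Rintegral_ge0 => x /f0 /ltW.
move/(ae_eq_integral_abs mu mB mfB); apply: filterS => x fx Dx.
rewrite leNgt; apply/negP => fx0.
have Bx : B x by split => //=; rewrite in_itv/= fx0.
by move: (fx Bx) fx0 => /= [->]; rewrite ltxx.
Qed.

(** A nonnegative function with zero integral vanishes almost everywhere. In the applications [g] is
    a coercive lower bound of the integrand [f]. *)
Lemma ae_eq0_Rintegral f g : mu.-integrable D (EFin \o f) ->
  (\forall x \ae mu, D x -> 0 <= g x <= f x) -> \int[mu]_(x in D) f x = 0 ->
  \forall x \ae mu, D x -> g x = 0.
Proof.
move=> intf gf If; have mf := measurable_int mu intf.
have : (\int[mu]_(x in D) `|(EFin \o f) x|)%E = 0%E.
  transitivity (\int[mu]_(x in D) (f x)%:E)%E.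
    apply: ae_eq_integral => //; first exact: measurableT_comp.
    apply: filterS gf => x gf Dx /=.
    by have /andP[g0 gfx] := gf Dx; rewrite ger0_norm// (le_trans g0).
  by rewrite -(fineK (integrable_fin_num mD intf)); congr EFin.
move/(ae_eq_integral_abs mu mD mf) => f0; apply: filterS2 gf f0 => x gf f0 Dx.
by have := gf Dx; case: (f0 Dx) => ->; rewrite -eq_le => /eqP.
Qed.

(** By Cauchy-Schwarz the error is at most the norm of [h] times that of [w_ k - w]. This carries
    identities for test functions over to their H^1 limits. *)
Lemma cvg_Rintegral_Lnorm2 h (w_ : nat -> T -> R) w :
  (h \_ D) \in Lfun mu 2%:E -> (w \_ D) \in Lfun mu 2%:E ->
  (forall k, (w_ k \_ D) \in Lfun mu 2%:E) ->
  'N[mu]_2%:E[EFin \o ((w_ k \- w)%R \_ D)]%E @[k --> \oo] --> 0%E ->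
  (\int[mu]_(x in D) (h x * w_ k x))%R @[k --> \oo] -->
  (\int[mu]_(x in D) (h x * w x))%R.
Proof.
move=> h2 w2 wk2 wcvg.
have hoo : ('N[mu]_2%:E[EFin \o (h \_ D)] < +oo)%E.
  by move: h2; rewrite inE => /andP[_]; rewrite inE.
have bound k : (`|(\int[mu]_(x in D) (h x * w_ k x) -
    \int[mu]_(x in D) (h x * w x))%R|%:E <=
    'N[mu]_2%:E[EFin \o (h \_ D)] *
    'N[mu]_2%:E[EFin \o ((w_ k \- w)%R \_ D)])%E.
  have dk2 : ((w_ k \- w)%R \_ D) \in Lfun mu 2%:E by exact: Lfun2_restrictB.
  have mm f : (f \_ D) \in Lfun mu 2%:E -> measurable_fun setT (f \_ D).
    by move/Lfun_restrict_measurable => mf; exact/(measurable_restrictT f mD).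
  apply: (@le_trans _ _ 'N[mu]_1[EFin \o ((h \_ D) \* ((w_ k \- w) \_ D))%R]%E);
    last first.
    apply: (@hoelder _ _ _ _ _ _ 2 2) => //; try exact: mm.
    by rewrite [RHS]splitr !div1r.
  rewrite -RintegralB//; [|exact: Lfun2_restrictM..].
  have iB : mu.-integrable D (EFin \o (fun x => h x * w_ k x - h x * w x)).
    exact: (integrableB mD (Lfun2_restrictM h2 (wk2 k)) (Lfun2_restrictM h2 w2)).
  rewrite EFin_normr_Rintegral//.
  apply: le_trans (le_abse_integral _ _ _) _ => //; first exact: measurable_int iB.
  rewrite Lnorm1 integral_mkcond le_eqVlt; apply/orP; left; apply/eqP.
  apply: eq_integral => x _ /=; rewrite !patchE; case: ifPn => /= _.
    by rewrite mulrBr.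
  by rewrite -[LHS]/(0%E) -[point]/(0 : R) mul0r normr0.
apply/cvgrPdist_lt => e e0.
have cv : ('N[mu]_2%:E[EFin \o (h \_ D)] *
    'N[mu]_2%:E[EFin \o ((w_ k \- w)%R \_ D)])%E @[k --> \oo] --> 0%E.
  have hfin : 'N[mu]_2%:E[EFin \o (h \_ D)]%E \is a fin_num.
    by rewrite ge0_fin_numE// Lnorm_ge0.
  rewrite -(mule0 'N[mu]_2%:E[EFin \o (h \_ D)]%E).
  by apply: cvgeZl.
have e0' : (0 < e%:E)%E by rewrite lte_fin.
have ke : \forall k \near \oo, ('N[mu]_2%:E[EFin \o (h \_ D)] *
    'N[mu]_2%:E[EFin \o ((w_ k \- w)%R \_ D)] < e%:E)%E.
  apply: (cv [set y : \bar R | (y < e%:E)%E]).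
  by apply: open_nbhs_nbhs; split => //; exact: open_ereal_lt_ereal.
near=> k; rewrite -lte_fin distrC; apply: le_lt_trans (bound k) _.
by near: k.
Unshelve. all: by end_near. Qed.

End square_integrable_on_set.

(** * Lebesgue measure and the topology of R^n *)

Section lebesgue_rV_topology.
Context {R : realType} {n : nat}.
Local Notation E := 'rV[R]_n.
Local Notation leb := (@lebesgue_rV R n).

Lemma measurable_box (A : 'I_n -> set R) : (forall i, measurable (A i)) ->
  measurable [set x : E | forall i, A i (x ord0 i)].
Proof.
move=> mA; rewrite (_ : [set _ | _] = \bigcap_(i in [set: 'I_n])
    ((fun v : E => v ord0 i) @^-1` A i)).
  apply: fin_bigcap_measurable => // i _.
  by rewrite -[X in measurable X]setTI; exact: measurable_coor.
by apply/seteqP; split => v /= H i; [move=> _|]; exact: H.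
Qed.

Lemma open_rV_box (A : set E) (x : E) : open A -> A x ->
  exists2 e : R, 0 < e & [set y : E | forall i, `|x ord0 i - y ord0 i| < e] `<=` A.
Proof.
move=> oA Ax; have /nbhs_ballP[e /= e0 xeA] : nbhs x A by exact: open_nbhs_nbhs.
exists e => // y /= xy; apply: xeA; split => // i j.
by rewrite (ord1 i); exact: xy.
Qed.

(** Links the topology to the sigma-algebra generated by the coordinates: an open set is the
    countable union of the cubes inside it with rational centre and radius [1/(k+1)]. *)
Lemma open_rV_measurable (A : set E) : open A -> measurable A.
Proof.
move=> oA.
pose itv (qk : 'rV[rat]_n * nat) i : set R :=
  `](ratr (qk.1 ord0 i) - qk.2.+1%:R^-1),
    (ratr (qk.1 ord0 i) + qk.2.+1%:R^-1)[%classic.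
pose box qk : set E := [set x | forall i, itv qk i (x ord0 i)].
have -> : A = \bigcup_qk (if `[< box qk `<=` A >] then box qk else set0).
  apply/seteqP; split => [x Ax|x [qk _]]; last first.
    by case: ifPn => [/asboolP|//]; exact.
  have [e e0 xeA] := open_rV_box oA Ax.
  (* Half of [e], because a point of the cube reaches [x] through the rational centre, at two
     distances below [1/(k+1)]. *)
  have [k ke] : exists k : nat, k.+1%:R^-1 < e / 2.
    have e20 : 0 < e / 2 by rewrite divr_gt0.
    near \oo => k; exists k.
    by near: k; exact: near_infty_natSinv_lt (PosNum e20).
  have k0 : 0 < k.+1%:R^-1 :> R by rewrite invr_gt0.
  have qex (i : 'I_n) : exists q : rat,
      x ord0 i - k.+1%:R^-1 < ratr q < x ord0 i + k.+1%:R^-1.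
    have [|q] := @rat_in_itvoo _ (x ord0 i - k.+1%:R^-1) (x ord0 i + k.+1%:R^-1).
      by rewrite ltrBlDr -addrA ltrDl addr_gt0.
    by rewrite in_itv => qi; exists q.
  have [q qP] := choice qex.
  exists (\row_i q i, k) => //.
  have qx i : `|x ord0 i - ratr (q i)| < k.+1%:R^-1.
    by rewrite distrC ltr_distl qP.
  rewrite asboolT => [|y yb]; first by move=> i; rewrite /itv /= mxE in_itv/= -ltr_distl.
  apply: xeA => i; rewrite (splitr e) -(subrKA (ratr (q i))).
  apply: le_lt_trans (ler_normD _ _) _; apply: ltrD; first exact: lt_trans ke.
  have := yb i; rewrite /itv /= mxE in_itv/= -ltr_distl distrC => /lt_trans; exact.
apply: countable_bigcupT_measurable; first by apply: countableP.
move=> qk; case: ifPn => // _; apply: (@measurable_box (itv qk)) => i.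
exact: measurable_itv.
Unshelve. all: by end_near. Qed.

Lemma continuous_rV_measurable (f : E -> R) :
  continuous f -> measurable_fun setT f.
Proof.
move=> /continuousP cf; apply: (measurability _ (RGenOpens.measurableE R)).
move=> _ [_ [a [b ->] <-]]; rewrite setTI; apply: open_rV_measurable.
exact/cf/interval_open.
Qed.

Lemma bounded_set_sub_box (A : set E) : bounded_set A -> exists M : R,
  A `<=` [set x : E | forall i, (`[- M, M]%classic : set R) (x ord0 i)].
Proof.
(* Boundedness only provides bounds strictly larger than [M], hence [M + 1]. *)
move=> [M [_ Mb]]; exists (M + 1) => x Ax i /=; rewrite in_itv/= -ler_norml.
apply: le_trans (Mb (M + 1) _ x Ax); last by rewrite ltrDl.
rewrite -[leRHS]/(mx_norm x) mx_normrE.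
exact: (@le_bigmax_cond _ _ _ _ (ord0, i) xpredT (fun ij => `|x ij.1 ij.2|)).
Qed.

Lemma bounded_lebesgue_rV_lty (A : set E) : measurable A -> bounded_set A ->
  (leb A < +oo)%E.
Proof.
move=> mA /bounded_set_sub_box[M AM].
pose itv (i : 'I_n) : set R := `[- M, M]%classic.
have mitv i : measurable (itv i) by exact: measurable_itv.
apply: (@le_lt_trans _ _ (leb [set x : E | forall i, itv i (x ord0 i)])).
  by apply: le_measure; rewrite ?inE//; exact: (@measurable_box itv).
(* The sign of [M] is unknown; for [M <= 0] the interval has length zero, whence the maximum. *)
rewrite lebesgue_rV_box// (eq_bigr (fun=> (Num.max 0 (M + M))%:E)) => [|i _].
  by rewrite prodEFin ltry.
rewrite lebesgue_measure_itv/= lte_fin.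
have [MM|MM] := ltrP (- M) M; last by rewrite max_l//; lra.
by rewrite -EFinB opprK max_r//; lra.
Qed.

Lemma open_lebesgue_rV_gt0 (A : set E) : open A -> A !=set0 -> (0 < leb A)%E.
Proof.
move=> oA [x Ax]; have [e e0 xeA] := open_rV_box oA Ax.
pose itv i : set R := `](x ord0 i - e), (x ord0 i + e)[%classic.
have mitv i : measurable (itv i) by exact: measurable_itv.
apply: (@lt_le_trans _ _ (leb [set y : E | forall i, itv i (y ord0 i)])).
  rewrite lebesgue_rV_box// (eq_bigr (fun=> (e + e)%:E)) => [|i _].
    by rewrite prodEFin lte_fin prodr_gt0// => i _; rewrite addr_gt0.
  rewrite lebesgue_measure_itv/= lte_fin ltrBlDr -addrA ltrDl addr_gt0//.
  by rewrite -EFinB; congr EFin; lra.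
apply: le_measure; rewrite ?inE//.
- exact: (@measurable_box itv).
- exact: open_rV_measurable.
- move=> y yb; apply: xeA => i; have := yb i.
  by rewrite /itv /= in_itv/= -ltr_distl distrC.
Qed.

End lebesgue_rV_topology.

(** * Test functions *)

Section test_functions.
Context {R : realType} {n : nat}.
Local Notation E := 'rV[R]_n.
Implicit Types (Omega : set E) (phi : E -> R).

Lemma derivable_coor (j : 'I_n) (x v : E) :
  derivable (fun x : E => x ord0 j) x v.
Proof. by apply/(derivable_mxP id x v).1; exact: derivable_id. Qed.

Lemma derive_coor (j : 'I_n) (x v : E) :
  'D_v (fun x : E => x ord0 j) x = v ord0 j.
Proof.
have /matrixP/(_ ord0 j) := derive_mx (@derivable_id _ _ x v).
by rewrite mxE derive_id.
Qed.

Lemma CkW k phi : Ck k.+1 phi -> Ck k phi.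
Proof.
elim: k phi => [|k IHk] phi [cphi dphi]; split => // i.
by have [? ?] := dphi i; split => //; exact: IHk.
Qed.

Lemma Ck_add k phi psi : Ck k phi -> Ck k psi -> Ck k (phi + psi).
Proof.
elim: k phi psi => [|k IHk] phi psi [cphi dphi] [cpsi dpsi]; split => //.
- by move=> x; apply: continuousD; [exact: cphi|exact: cpsi].
- by move=> x; apply: continuousD; [exact: cphi|exact: cpsi].
move=> i; have [Dphi Cphi] := dphi i; have [Dpsi Cpsi] := dpsi i.
split; first by move=> x; exact: derivableD.
rewrite (_ : partial i _ = partial i phi + partial i psi); first exact: IHk.
by apply/funext => x; rewrite /partial deriveD.
Qed.

Lemma Ck_scale k (c : R) phi : Ck k phi -> Ck k (c \*: phi).
Proof.
elim: k phi => [|k IHk] phi [cphi dphi]; split => //.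
- by move=> x; apply: continuousZl_tmp; exact: cphi.
- by move=> x; apply: continuousZl_tmp; exact: cphi.
move=> i; have [Dphi Cphi] := dphi i.
split; first by move=> x; exact: derivableZ.
rewrite (_ : partial i _ = c \*: partial i phi); first exact: IHk.
by apply/funext => x; rewrite /partial deriveZ.
Qed.

Lemma partial_coorM (i j : 'I_n) phi :
  (forall x, derivable phi x (delta_mx ord0 i)) ->
  partial i ((fun x : E => x ord0 j) * phi) =
  (fun x : E => x ord0 j) * partial i phi + (i == j)%:R \*: phi.
Proof.
move=> dphi; apply/funext => x; rewrite /partial deriveM//; last first.
  exact: derivable_coor.
by rewrite derive_coor mxE eqxx/= eq_sym /GRing.scale/= [phi x * _]mulrC.
Qed.

(** Induction on [k]: by the product rule each partial derivative is [x_j] times a partial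
    derivative of [phi] plus a multiple of [phi], so only sums and scalings of less regular
    functions arise. *)
Lemma Ck_coorM k (j : 'I_n) phi :
  Ck k phi -> Ck k ((fun x : E => x ord0 j) * phi).
Proof.
elim: k phi => [|k IHk] phi Cphi; have [cphi dphi] := Cphi; split => //.
- by move=> x; apply: continuousM; [exact: coord_continuous|exact: cphi].
- by move=> x; apply: continuousM; [exact: coord_continuous|exact: cphi].
move=> i; have [Dphi Cdphi] := dphi i; split.
  by move=> x; apply: derivableM => //; exact: derivable_coor.
rewrite partial_coorM//; apply: Ck_add; first exact: IHk.
by apply: Ck_scale; exact: CkW.
Qed.

Lemma test_function_coorM Omega (j : 'I_n) phi : test_function Omega phi ->
  test_function Omega ((fun x : E => x ord0 j) * phi).
Proof.
move=> [Cphi cphi sphi].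
have supp : support_closure ((fun x : E => x ord0 j) * phi) `<=`
    support_closure phi.
  apply: closureS => x /=; apply: contraNN => /eqP phi0.
  by rewrite -[X in X == _]/(x ord0 j * phi x) phi0 mulr0.
split; [by move=> k; exact: Ck_coorM| |exact: subset_trans sphi].
by apply: (subclosed_compact _ cphi supp); exact: closed_closure.
Qed.

Lemma test_function_continuous Omega phi :
  test_function Omega phi -> continuous phi.
Proof. by move=> [/(_ 0)[]]. Qed.

Lemma test_function_partial_continuous Omega i phi :
  test_function Omega phi -> continuous (partial i phi).
Proof. by move=> [/(_ 1)[_ /(_ i)[_ []]]]. Qed.

(** [Omega] lies in a closed cube, compact as a product of segments, and the continuous image of a
    compact set is bounded. *)
Lemma continuous_bounded_set_Lpy Omega (f : E -> R) :
  measurable Omega -> bounded_set Omega -> continuous f -> Lp Omega +oo%E f.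
Proof.
move=> mO /bounded_set_sub_box[M]; set K := [set x | _] => OK cf.
have cK : compact K.
  apply: (@rV_compact _ _ (fun=> `[- M, M]%classic)) => _.
  exact: segment_compact.
have /compact_bounded[N [_ Nf]] : compact (f @` K).
  by apply: continuous_compact => //; exact: continuous_subspaceT.
apply: (@Lfuny_restrict _ _ _ _ _ _ _ (N + 1)) => //.
  by apply: measurable_funTS; exact: continuous_rV_measurable.
apply: nearW => x /OK Kx; apply: (Nf (N + 1)); first by rewrite ltrDl.
by exists x.
Qed.

End test_functions.

(** * Uniqueness of weak solutions *)

Section linear_combination.
Context {d : measure_display} {T : measurableType d} {R : realType}.
Variables (mu : {measure set T -> \bar R}) (D : set T).

(** If the [f] are the values of a bilinear form at [(y,y)], [(y,z)], [(z,y)], [(z,z)], the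
    combination is its value at [y - z]. Testing is thus done with [y] and [z] only. *)
Lemma Rintegral_second_difference (f1 f2 f3 f4 : T -> R) : measurable D ->
  mu.-integrable D (EFin \o f1) -> mu.-integrable D (EFin \o f2) ->
  mu.-integrable D (EFin \o f3) -> mu.-integrable D (EFin \o f4) ->
  mu.-integrable D (EFin \o (fun x => f1 x - f2 x - (f3 x - f4 x))) /\
  \int[mu]_(x in D) (f1 x - f2 x - (f3 x - f4 x)) =
  \int[mu]_(x in D) f1 x - \int[mu]_(x in D) f2 x -
  (\int[mu]_(x in D) f3 x - \int[mu]_(x in D) f4 x).
Proof.
move=> mD i1 i2 i3 i4.
have i12 : mu.-integrable D (EFin \o (fun x => f1 x - f2 x)).
  exact: (integrableB mD i1 i2).
have i34 : mu.-integrable D (EFin \o (fun x => f3 x - f4 x)).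
  exact: (integrableB mD i3 i4).
split; first exact: (integrableB mD i12 i34).
by rewrite !RintegralB.
Qed.

End linear_combination.

Section sobolev_uniqueness.
Context {R : realType} {n : nat}.
Local Notation E := 'rV[R]_n.
Local Notation leb := (@lebesgue_rV R n).
Variable Omega : set E.
Hypotheses (oO : open Omega) (bO : bounded_set Omega).

Let mO : measurable Omega. Proof. exact: open_rV_measurable. Qed.

Let fO : (leb Omega < +oo)%E. Proof. exact: bounded_lebesgue_rV_lty. Qed.

Let coor_Lpy (j : 'I_n) : Lp Omega +oo%E (fun x : E => x ord0 j).
Proof.
by apply: continuous_bounded_set_Lpy => // x; exact: coord_continuous.
Qed.

Let continuous_Lp2 (f : E -> R) : continuous f -> Lp Omega 2%:E f.
Proof.
by move=> cf; apply: Lfuny_Lfun2_restrict => //; exact: continuous_bounded_set_Lpy.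
Qed.

(* The weak derivative of [y] is tested with [x_j * phi_k], where the [phi_k]
   are test functions converging to [w]. *)
Lemma in_H1_H10_coor (j : 'I_n) (y w : E -> R) dy dw :
  in_H1 Omega y dy -> in_H10 Omega w dw ->
  leb.-integrable Omega (EFin \o (fun x : E =>
    y x * w x + (x ord0 j * y x * dw j x + x ord0 j * dy j x * w x))) /\
  \int[leb]_(x in Omega)
    (y x * w x + (x ord0 j * y x * dw j x + x ord0 j * dy j x * w x)) = 0.
Proof.
move=> [y2 dy2 ydy] [[w2 dw2 _] [phi [tphi phiw dphiw]]].
have xy2 : Lp Omega 2%:E (fun x : E => x ord0 j * y x).
  exact: (Lfuny_Lfun2_restrictM mO (coor_Lpy j) y2).
have xdy2 : Lp Omega 2%:E (fun x : E => x ord0 j * dy j x).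
  exact: (Lfuny_Lfun2_restrictM mO (coor_Lpy j) (dy2 j)).
have phi2 k : Lp Omega 2%:E (phi k).
  exact: (continuous_Lp2 (test_function_continuous (tphi k))).
have dphi2 k : Lp Omega 2%:E (partial j (phi k)).
  by apply: continuous_Lp2; exact: (test_function_partial_continuous (tphi k)).
have iyw v : Lp Omega 2%:E v ->
    leb.-integrable Omega (EFin \o (fun x : E => y x * v x)).
  by move=> v2; exact: (Lfun2_restrictM mO y2 v2).
have ixyw v : Lp Omega 2%:E v ->
    leb.-integrable Omega (EFin \o (fun x : E => x ord0 j * y x * v x)).
  by move=> v2; exact: (Lfun2_restrictM mO xy2 v2).
have ixdyw v : Lp Omega 2%:E v ->
    leb.-integrable Omega (EFin \o (fun x : E => x ord0 j * dy j x * v x)).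
  by move=> v2; exact: (Lfun2_restrictM mO xdy2 v2).
have isum v dv : Lp Omega 2%:E v -> Lp Omega 2%:E dv ->
    leb.-integrable Omega (EFin \o (fun x : E =>
      x ord0 j * y x * dv x + x ord0 j * dy j x * v x)).
  by move=> v2 dv2; exact: (integrableD mO (ixyw _ dv2) (ixdyw _ v2)).
have sumE v dv : Lp Omega 2%:E v -> Lp Omega 2%:E dv ->
    \int[leb]_(x in Omega)
      (y x * v x + (x ord0 j * y x * dv x + x ord0 j * dy j x * v x)) =
    \int[leb]_(x in Omega) (y x * v x) +
    (\int[leb]_(x in Omega) (x ord0 j * y x * dv x) +
     \int[leb]_(x in Omega) (x ord0 j * dy j x * v x)).
  move=> v2 dv2; rewrite RintegralD//; [|exact: iyw|exact: isum].
  by rewrite RintegralD//; [exact: ixyw|exact: ixdyw].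
split; first exact: (integrableD mO (iyw _ w2) (isum _ _ w2 (dw2 j))).
rewrite sumE//.
(* The [j]-th partial derivative of [x_j * phi k] is [phi k + x_j * partial j (phi k)]; its first
   term is the source of the integral of [y * w]. *)
have zero k : \int[leb]_(x in Omega) (y x * phi k x) +
    (\int[leb]_(x in Omega) (x ord0 j * y x * partial j (phi k) x) +
     \int[leb]_(x in Omega) (x ord0 j * dy j x * phi k x)) = 0.
  have := ydy j _ (test_function_coorM j (tphi k)).
  have [/(_ 1)[_ /(_ j)[dphi _]] _ _] := tphi k.
  rewrite partial_coorM// eqxx.
  rewrite (@eq_Rintegral _ _ _ leb Omega (fun x : E => y x * phi k x +
    x ord0 j * y x * partial j (phi k) x)); last first.
    by move=> x _; rewrite !fctE/= scale1r; ring.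
  rewrite RintegralD//; [|exact: iyw|exact: ixyw].
  rewrite [X in _ = - X](@eq_Rintegral _ _ _ leb Omega
    (fun x : E => x ord0 j * dy j x * phi k x)).
    by move=> H; rewrite addrA H addNr.
  by move=> x _; rewrite !fctE; ring.
have cv : (\int[leb]_(x in Omega) (y x * phi k x) +
    (\int[leb]_(x in Omega) (x ord0 j * y x * partial j (phi k) x) +
     \int[leb]_(x in Omega) (x ord0 j * dy j x * phi k x)))%R @[k --> \oo] -->
    (\int[leb]_(x in Omega) (y x * w x) +
    (\int[leb]_(x in Omega) (x ord0 j * y x * dw j x) +
     \int[leb]_(x in Omega) (x ord0 j * dy j x * w x)))%R.
  apply: cvgD; first exact: (cvg_Rintegral_Lnorm2 mO y2 w2 phi2 phiw).
  apply: cvgD; first exact: (cvg_Rintegral_Lnorm2 mO xy2 (dw2 j) dphi2 (dphiw j)).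
  exact: (cvg_Rintegral_Lnorm2 mO xdy2 w2 phi2 phiw).
move: cv; rewrite (funext zero : _ = cst 0) => /(cvg_lim (@norm_hausdorff _ _)).
by rewrite lim_cst.
Qed.

(** At [q = y - z] the preceding identity reads [\int (q^2 + 2 x_j q d_j q) = 0], and [d_j q = 0]
    leaves [\int q^2 = 0]. The zero boundary values make one direction sufficient. *)
Lemma in_H10_ae_eq (j : 'I_n) (y z : E -> R) dy dz :
  in_H10 Omega y dy -> in_H10 Omega z dz ->
  (\forall x \ae leb, Omega x -> dy j x = dz j x) ->
  \forall x \ae leb, Omega x -> y x = z x.
Proof.
move=> Hy Hz dyz.
have [iyy yy] := in_H1_H10_coor j Hy.1 Hy.
have [iyz yz] := in_H1_H10_coor j Hy.1 Hz.
have [izy zy] := in_H1_H10_coor j Hz.1 Hy.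
have [izz zz] := in_H1_H10_coor j Hz.1 Hz.
have [iq Iq] := Rintegral_second_difference mO iyy iyz izy izz.
rewrite yy yz zy zz !subr0 in Iq.
suff : \forall x \ae leb, Omega x -> (y x - z x) ^+ 2 = 0.
  apply: filterS => x + Ox => /(_ Ox)/eqP.
  by rewrite sqrf_eq0 subr_eq0 => /eqP.
apply: (ae_eq0_Rintegral mO iq _ Iq); apply: filterS dyz => x + Ox => /(_ Ox) ->.
by rewrite sqr_ge0/= le_eqVlt; apply/orP; left; apply/eqP; ring.
Qed.

(** Ellipticity only concerns the quadratic form, which transposition does not change; this serves
    the adjoint operator. *)
Lemma elliptic_coefficients_tr (a : 'I_n -> 'I_n -> E -> R) a0 :
  elliptic_coefficients Omega a a0 ->
  elliptic_coefficients Omega (fun i j => a j i) a0.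
Proof.
move=> [ay a0y a00 [l l0 al]]; split => //; exists l => //.
apply: filterS al => x + Ox xi => /(_ Ox xi) /le_trans; apply.
rewrite exchange_big/= le_eqVlt; apply/orP; left; apply/eqP.
by apply: eq_bigr => i _; apply: eq_bigr => j _; rewrite -!mulrA [xi _ _ * _]mulrC.
Qed.

(** Energy argument: the form at [p1 - p2] integrates to zero, while ellipticity and the signs of
    [a0] and [chi1] bound its integrand below by [l] times the squared gradient of the
    difference. *)
Lemma weak_solution_ae_eq (j : 'I_n) (a : 'I_n -> 'I_n -> E -> R)
    (a0 chi1 chi2 g p1 p2 : E -> R) :
  elliptic_coefficients Omega a a0 ->
  Lp Omega +oo%E chi1 -> Lp Omega +oo%E chi2 ->
  (\forall x \ae leb, Omega x -> 0 <= chi1 x /\ chi1 x = chi2 x) ->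
  weak_solution Omega a a0 (chi1 \* p1) g p1 ->
  weak_solution Omega a a0 (chi2 \* p2) g p2 ->
  \forall x \ae leb, Omega x -> p1 x = p2 x.
Proof.
move=> [ay a0y a0_ge0 [l l0 al]] chi1y chi2y chi12 [d1 H1 w1] [d2 H2 w2].
have Lp2 p dp : in_H10 Omega p dp ->
  Lp Omega 2%:E p /\ forall i, Lp Omega 2%:E (dp i) by move=> [[]].
have iform chi p dp v dv : Lp Omega +oo%E chi ->
    in_H10 Omega p dp -> in_H10 Omega v dv ->
    leb.-integrable Omega (EFin \o (fun x : E =>
      (\sum_(i < n) \sum_(k < n) a i k x * dp i x * dv k x)
      + a0 x * p x * v x + (chi \* p) x * v x)).
  move=> chiy /Lp2[p2' dp2] /Lp2[v2 dv2].
  apply: (@integrableD _ _ _ leb _ mO (EFin \o (fun x : E =>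
    (\sum_(i < n) \sum_(k < n) a i k x * dp i x * dv k x) + a0 x * p x * v x))
    (EFin \o (fun x : E => (chi \* p) x * v x))); last first.
    exact: (Lfun2_restrictM mO (Lfuny_Lfun2_restrictM mO chiy p2') v2).
  apply: (@integrableD _ _ _ leb _ mO (EFin \o (fun x : E =>
    (\sum_(i < n) \sum_(k < n) a i k x * dp i x * dv k x)))
    (EFin \o (fun x : E => a0 x * p x * v x))); last first.
    exact: (Lfun2_restrictM mO (Lfuny_Lfun2_restrictM mO a0y p2') v2).
  rewrite (_ : _ \o _ = fun x : E => (\sum_(i < n) \sum_(k < n)
    (a i k x * dp i x * dv k x)%:E)%E); last first.
    by apply/funext => x /=; rewrite -sumEFin; apply: eq_bigr => i _; rewrite -sumEFin.
  apply: integrable_sum => // i _; apply: integrable_sum => // k _.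
  exact: (Lfun2_restrictM mO (Lfuny_Lfun2_restrictM mO (ay i k) (dp2 i)) (dv2 k)).
have [iq Iq] := Rintegral_second_difference mO (iform _ _ _ _ _ chi1y H1 H1)
  (iform _ _ _ _ _ chi1y H1 H2) (iform _ _ _ _ _ chi2y H2 H1)
  (iform _ _ _ _ _ chi2y H2 H2).
(* The right-hand side depends on the test function alone, so the four values cancel in pairs. *)
rewrite (w1 _ _ H1) (w1 _ _ H2) (w2 _ _ H1) (w2 _ _ H2) subrr in Iq.
have dq0 : \forall x \ae leb, Omega x ->
    l * (\sum_(i < n) (d1 i x - d2 i x) ^+ 2) = 0.
  apply: (ae_eq0_Rintegral mO iq _ Iq).
  apply: filterS3 al a0_ge0 chi12 => x al' a0' chi' Ox.
  have {}al' : l * (\sum_(i < n) (d1 i x - d2 i x) ^+ 2) <= \sum_(i < n)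
      \sum_(k < n) a i k x * (d1 i x - d2 i x) * (d1 k x - d2 k x).
    have := al' Ox (\row_i (d1 i x - d2 i x)).
    rewrite (eq_bigr (fun i => (d1 i x - d2 i x) ^+ 2)); last first.
      by move=> i _; rewrite mxE.
    move=> /le_trans; apply; rewrite le_eqVlt; apply/orP; left; apply/eqP.
    by apply: eq_bigr => i _; apply: eq_bigr => k _; rewrite !mxE.
  have {}a0' := a0' Ox; have [chi1_ge0 chi12x] := chi' Ox.
  rewrite mulr_ge0 ?(ltW l0)//=; last by apply: sumr_ge0 => i _; exact: sqr_ge0.
  (* Where [chi1 = chi2], the four terms regroup into the principal part at [d1 - d2] and a
     nonnegative zero-order part. *)
  rewrite [X in _ <= X](_ : _ =
    (\sum_(i < n) \sum_(k < n) a i k x * (d1 i x - d2 i x) * (d1 k x - d2 k x))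
    + (a0 x + chi1 x) * (p1 x - p2 x) ^+ 2).
    by apply: le_trans al' _; rewrite lerDl mulr_ge0 ?sqr_ge0// addr_ge0.
  rewrite /= -chi12x.
  rewrite (_ : \sum_(i < n) \sum_(k < n) a i k x * (d1 i x - d2 i x) *
      (d1 k x - d2 k x) =
    (\sum_(i < n) \sum_(k < n) a i k x * d1 i x * d1 k x) -
    (\sum_(i < n) \sum_(k < n) a i k x * d1 i x * d2 k x) -
    ((\sum_(i < n) \sum_(k < n) a i k x * d2 i x * d1 k x) -
    (\sum_(i < n) \sum_(k < n) a i k x * d2 i x * d2 k x))); first by ring.
  rewrite -!sumrB; apply: eq_bigr => i _; rewrite -!sumrB.
  by apply: eq_bigr => k _; ring.
apply: (in_H10_ae_eq (j := j) H1 H2); apply: filterS dq0 => x + Ox => /(_ Ox)/eqP.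
rewrite mulf_eq0 gt_eqF//= psumr_eq0 => [|i _]; last exact: sqr_ge0.
move=> /allP/(_ j); rewrite mem_index_enum => /(_ isT).
by rewrite /= sqrf_eq0 subr_eq0 => /eqP.
Qed.

(** If the functions differ at a point of the closure, they differ on the closure throughout a
    neighbourhood. This neighbourhood meets [Omega] in a nonempty open set, which has positive
    measure. *)
Lemma ae_eq_closure_continuous (p1 p2 : E -> R) :
  {within closure Omega, continuous p1} ->
  {within closure Omega, continuous p2} ->
  (\forall x \ae leb, Omega x -> p1 x = p2 x) ->
  forall x, closure Omega x -> p1 x = p2 x.
Proof.
move=> /subspace_continuousP c1 /subspace_continuousP c2 p12 x cx.
apply: contrapT => /eqP; rewrite -subr_eq0 => pn.
have c12 : (p1 z - p2 z) @[z --> within (closure Omega) (nbhs x)] --> p1 x - p2 x.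
  by apply: cvgB; [exact: c1|exact: c2].
have : nbhs (p1 x - p2 x) [set t : R | t != 0].
  by apply: open_nbhs_nbhs; split => //; exact: open_neq.
move=> /c12; rewrite /= /within/= nbhs_simpl/= => pn0.
have {pn0}: nbhs x [set z | closure Omega z -> p1 z - p2 z != 0] by exact: pn0.
rewrite nbhsE => -[B [oB Bx] Bp].
have [z [Oz Bz]] : Omega `&` B !=set0.
  by apply: cx; exact: open_nbhs_nbhs.
case: p12 => N [mN N0 p12N].
have : (0 < leb (Omega `&` B))%E.
  by apply: open_lebesgue_rV_gt0; [exact: openI|exists z].
apply/negP; rewrite -leNgt -N0; apply: le_measure; rewrite ?inE//.
  by apply: open_rV_measurable; exact: openI.
move=> t [Ot Bt]; apply: p12N => /= /(_ Ot) p12t.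
by have /eqP := Bp t Bt (subset_closure Ot); rewrite p12t subrr.
Qed.

End sobolev_uniqueness.

(** * Clarke subdifferential of a piecewise C2 function *)

Section clarke.
Context {R : realType}.
Implicit Types (f g : R -> R) (t : R).

(** The upper limit is an infimum of suprema over the members of the filter, and the product [V] of
    a ball and []0, e[] is one of them. *)
Lemma clarke_dir_derivative_le f t (h B e : R) : 0 < e ->
  (forall s l, `|t - s| < e -> 0 < l < e -> (f (s + l * h) - f s) / l <= B) ->
  (clarke_dir_derivative f t h <= B%:E)%E.
Proof.
move=> e0 fB; rewrite /clarke_dir_derivative limf_esupE.
pose V := [set sl : R * R | `|t - sl.1| < e /\ 0 < sl.2 < e].
apply: (@le_trans _ _ (ereal_sup ((fun sl : R * R =>
    ((f (sl.1 + sl.2 * h) - f sl.1) / sl.2)%:E) @` V))).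
  apply: ereal_inf_lbound; exists V => //.
  exists (ball t e, `]0, e[%classic); first split => /=.
  - exact: nbhsx_ballx.
  - near=> l; rewrite /= in_itv/=; apply/andP; split; near: l.
      exact: nbhs_right_gt.
    exact: nbhs_right_lt.
  - by move=> [s l] /= [ts]; rewrite in_itv.
apply: ge_ereal_sup => _ [[s l] [/= ts le] <-].
by rewrite lee_fin; exact: fB.
Unshelve. all: by end_near. Qed.

(** Near [t] the difference quotients of [f] are those of [g]. Monotonicity makes them nonpositive
    in direction -1; the mean value theorem and continuity of [g'] bring them within [e] of
    [g'(t) * h]. Directions 1 and -1 then bound [xi] from above and from below. *)
Lemma clarke_subdifferential_C2 f g t xi : C2 g -> {homo g : s r / s <= r} ->
  (\forall s \near t, f s = g s) -> clarke_subdifferential f t xi ->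
  0 <= xi /\ xi = derive1 g t.
Proof.
move=> [dg ddg _] hg fg cxi.
have isdg (x : R) : is_derive x 1 g (derive1 g x).
  by rewrite derive1E; exact/derivableP.
have cg (x : R) : {for x, continuous g}.
  exact/differentiable_continuous/derivable1_diffP.
have cdg : {for t, continuous (derive1 g)}.
  exact/differentiable_continuous/derivable1_diffP.
have mvt a b : a < b -> exists2 c, a <= c <= b & g b - g a = derive1 g c * (b - a).
  move=> ab; have [c cab gE] := MVT_segment (ltW ab) (fun x _ => isdg x)
    (continuous_subspaceT cg).
  by exists c => //; move: cab; rewrite in_itv.
have bound e : 0 < e -> exists2 d : R, 0 < d & forall s, `|t - s| < d ->
    f s = g s /\ `|derive1 g t - derive1 g s| < e.
  move=> e0; have /nbhs_ballP[d /= d0 dP] : \forall s \near t,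
      f s = g s /\ `|derive1 g t - derive1 g s| < e.
    by apply: filterI => //; move/cvgrPdist_lt : cdg; exact.
  by exists d.
(* Allowing [d / 2] for the base point and [d / 2] for the step keeps both ends of the quotient
   within [d] of [t]. *)
have near2 (d s l h : R) : `|h| = 1 -> `|t - s| < d / 2 -> 0 < l < d / 2 ->
    `|t - s| < d /\ `|t - (s + l * h)| < d.
  move=> h1 ts /andP[l0 ld]; split; first by lra.
  rewrite opprD addrA (le_lt_trans (ler_normB _ _))// normrM h1 mulr1 gtr0_norm//.
  by lra.
have xi0 : 0 <= xi.
  have [d d0 dP] := bound 1 ltr01.
  have := cxi (-1); rewrite mulrN1 => /le_trans.
  move=> /(_ 0%E); rewrite lee_fin oppr_le0; apply.
  apply: (@clarke_dir_derivative_le _ _ _ _ (d / 2)); first by rewrite divr_gt0.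
  move=> s l ts ld; have [|ts1 ts2] := near2 d s l (-1) _ ts ld.
    by rewrite normrN1.
  have [-> _] := dP _ ts1; have [-> _] := dP _ ts2.
  have /andP[l0 _] := ld.
  by rewrite pmulr_lle0 ?invr_gt0// subr_le0 hg// mulrN1 gerBl ltW.
split=> //; apply/eqP; rewrite eq_le; apply/andP; split.
- apply/ler_addgt0Pr => e e0; have [d d0 dP] := bound e e0.
  have := cxi 1; rewrite mulr1 => /le_trans.
  move=> /(_ (derive1 g t + e)%:E); rewrite lee_fin; apply.
  apply: (@clarke_dir_derivative_le _ _ _ _ (d / 2)); first by rewrite divr_gt0.
  move=> s l ts ld; have [|ts1 ts2] := near2 d s l 1 _ ts ld.
    by rewrite normr1.
  have [-> _] := dP _ ts1; have [-> _] := dP _ ts2.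
  have /andP[l0 _] := ld; rewrite mulr1 in ts2 *.
  have [|c /andP[sc cl] ->] := mvt s (s + l); first by rewrite ltrDl.
  rewrite addrAC subrr add0r mulfK ?gt_eqF//.
  have [|_] := dP c; last by rewrite ltr_norml => /andP[? ?]; lra.
  by move: ts1 ts2; rewrite !ltr_norml => /andP[? ?] /andP[? ?]; apply/andP; split; lra.
- rewrite -lerN2; apply/ler_addgt0Pr => e e0; have [d d0 dP] := bound e e0.
  have := cxi (-1); rewrite mulrN1 => /le_trans.
  move=> /(_ (- derive1 g t + e)%:E); rewrite lee_fin; apply.
  apply: (@clarke_dir_derivative_le _ _ _ _ (d / 2)); first by rewrite divr_gt0.
  move=> s l ts ld; have [|ts1 ts2] := near2 d s l (-1) _ ts ld.
    by rewrite normrN1.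
  have [-> _] := dP _ ts1; have [-> _] := dP _ ts2.
  have /andP[l0 _] := ld; rewrite mulrN1 in ts2 *.
  have [|c /andP[sc cl] gE] := mvt (s - l) s; first by rewrite gtrBl.
  rewrite -opprB gE opprB addrCA subrr addr0 -mulNr mulfK ?gt_eqF//.
  have [|_] := dP c; last by rewrite ltr_norml => /andP[? ?]; lra.
  by move: ts1 ts2; rewrite !ltr_norml => /andP[? ?] /andP[? ?]; apply/andP; split; lra.
Qed.

(** Off the kinks [t] is interior to its cell, and near [t] only the indicator of that cell survives
    in the sum. *)
Lemma piecewise_C2_near K (tau : nat -> \bar R) (f_ : nat -> R -> R) f t :
  piecewise_C2 K tau f_ f ->
  ~ kinks K tau t ->
  exists g, [/\ C2 g, {homo g : s r / s <= r} & \forall s \near t, f s = g s].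
Proof.
move=> [_ [tau0 tauK tauS] fE f_C2 _] nkt.
have [i iK /andP[tit tit1]] : exists2 i, (i <= K)%N &
    (tau i < t%:E <= tau i.+1)%E.
  (* Induction on an upper cell index locates [t]; it starts from [tau 0 = -oo] and is used at
     [tau K.+1 = +oo]. *)
  suff H k : (k <= K)%N -> (t%:E <= tau k.+1)%E ->
      exists2 i, (i <= K)%N & (tau i < t%:E <= tau i.+1)%E.
    by apply: (H K) => //; rewrite tauK leey.
  elim: k => [|k IHk] kK tk.
    by exists 0%N => //; rewrite tau0 ltNyr.
  have [tk1|tk1] := leP t%:E (tau k.+1); first exact: IHk (ltnW kK) tk1.
  by exists k.+1 => //; rewrite tk1.
(* Cells contain their right endpoint, but this endpoint is either infinite or a kink. *)
have {}tit1 : (t%:E < tau i.+1)%E.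
  rewrite lt_neqAle tit1 andbT; apply/eqP => tE.
  move: iK; rewrite leq_eqVlt => /predU1P[iK|iK]; first by rewrite iK tauK in tE.
  by apply: nkt; exists i.+1; rewrite -?tE.
have tau_le a b : (a <= b <= K.+1)%N -> (tau a <= tau b)%E.
  elim: b => [|b IHb] /andP[ab bK]; first by move: ab; rewrite leqn0 => /eqP ->.
  move: ab; rewrite leq_eqVlt => /predU1P[->//|ab].
  by apply: le_trans (IHb _) (ltW (tauS _ _)) => //; rewrite -ltnS ab/= ltnW.
have [Cfi hfi] := f_C2 i iK.
exists (f_ i); split => //.
have : \forall s \near t, (tau i < s%:E < tau i.+1)%E.
  near=> s; apply/andP; split; near: s.
    case: (tau i) tit => [r|//|_]; last by apply: nearW => s; exact: ltNyr.
    by rewrite lte_fin; under eq_near do rewrite lte_fin; exact: lt_nbhsr.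
  case: (tau i.+1) tit1 => [r|_|//]; last by apply: nearW => s; exact: ltry.
  by rewrite lte_fin; under eq_near do rewrite lte_fin; exact: lt_nbhsl.
apply: filterS => s /andP[is1 si1]; rewrite fE.
have iK1 : (i < K.+1)%N by [].
rewrite (bigD1 (Ordinal iK1))//= big1 => [|j ji].
  by rewrite addr0 indicE mem_set ?mul1r//= is1 ltW.
rewrite indicE memNset ?mul0r//= => /andP[js sj].
have [ji'|ij'|jiE] := ltngtP j i.
- have := tau_le j.+1 i; rewrite ji' ltnW//= => /(_ isT) jle.
  by have := le_lt_trans (le_trans sj jle) is1; rewrite ltxx.
- have := tau_le i.+1 j; rewrite ij' ltnW//= => /(_ isT) ile.
  by have := lt_trans (lt_le_trans si1 ile) js; rewrite ltxx.
- by move/eqP : ji; apply; exact: val_inj.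
Unshelve. all: by end_near. Qed.

Lemma finite_kinks K (tau : nat -> \bar R) : finite_set (kinks K tau).
Proof.
apply: finite_image; apply: (@sub_finite_set _ _ `I_K.+1) => [i /= /andP[_]//|].
exact: finite_II.
Qed.

End clarke.

(** * Pointwise optimality conditions *)

Section pointwise_conditions.
Context {d : measure_display} {T : measurableType d} {R : realType}.
Variables (mu : {measure set T -> \bar R}) (D : set T).
Hypotheses (mD : measurable D) (fD : (mu D < +oo)%E).
Implicit Types (u v p lam : T -> R) (B : set T) (c : R).

Lemma Lfuny_restrict_integrable u :
  (u \_ D) \in Lfun mu +oo%E -> mu.-integrable D (EFin \o u).
Proof.
move=> uy; have u2 := Lfuny_Lfun2_restrict mD fD uy.
have c2 : ((cst 1 : T -> R) \_ D) \in Lfun mu 2%:E.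
  apply: Lfuny_Lfun2_restrict => //.
  apply: (@Lfuny_restrict _ _ _ _ _ mD _ 1); first exact: measurable_cst.
  by apply: nearW => x _; rewrite normr1.
have := Lfun2_restrictM mD u2 c2.
by apply: eq_integrable => // x _ /=; rewrite mulr1.
Qed.

(** The null sets of all rational constants merge into one by countability, here through the
    encoding [pickle] into [nat]. *)
Lemma ae_forall_rat (P : rat -> T -> Prop) :
  (forall q, \forall x \ae mu, P q x) -> \forall x \ae mu, forall q, P q x.
Proof.
move=> HP; have : \forall x \ae mu, forall k : nat,
    if unpickle k is Some q then P q x else True.
  by apply: ae_foralln => k; case: (unpickle k) => [q|]; [exact: HP|exact: nearW].
by apply: filterS => x Px q; have := Px (pickle q); rewrite pickleK.
Qed.

(** The competitor equal to [c] on [B] and to [u] elsewhere; the formula with an indicator reduces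
    its measurability to sums and products. *)
Let switch B c u : T -> R := fun x => u x + \1_B x * (c - u x).

Let switchE B c u x : switch B c u x = if x \in B then c else u x.
Proof.
rewrite /switch indicE; case: ifPn => _; last by rewrite mul0r addr0.
by rewrite mul1r addrCA subrr addr0.
Qed.

Let switch_Lfuny B c u : measurable B -> (u \_ D) \in Lfun mu +oo%E ->
  (switch B c u \_ D) \in Lfun mu +oo%E.
Proof.
move=> mB uy; have mu_ := Lfun_restrict_measurable mD uy.
have [M M0 uM] := Lfuny_restrict_bounded uy.
apply: (@Lfuny_restrict _ _ _ _ _ mD _ (Num.max M `|c|)).
  apply: measurable_funD => //; apply: measurable_funM; last exact: measurable_funB.
  by apply: measurable_funTS; exact: measurable_indic.
apply: filterS uM => x uM Dx; rewrite switchE le_max.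
by case: ifPn => _; rewrite ?lexx ?orbT// uM.
Qed.

Let Rintegral_switch B (g h : T -> R) : B `<=` D ->
  (forall x, D x -> h x = if x \in B then g x else 0) ->
  \int[mu]_(x in D) h x = \int[mu]_(x in B) g x.
Proof.
move=> BD hE; rewrite -[in RHS](setIidr BD) Rintegral_mkcondr.
by apply: eq_Rintegral => x /set_mem Dx; rewrite hE// patchE.
Qed.

(** Switching [u] to a rational [q] on arbitrary measurable sets localizes the inequality to
    [|u| + lam * (q - u) <= |q|] at almost every point, for all rational [q] at once. *)
Lemma subdifferential_l1_ae u lam :
  (u \_ D) \in Lfun mu +oo%E -> (lam \_ D) \in Lfun mu +oo%E ->
  (forall v, (v \_ D) \in Lfun mu 1%:E ->
    \int[mu]_(x in D) `|u x| + \int[mu]_(x in D) (lam x * (v x - u x)) <=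
    \int[mu]_(x in D) `|v x|) ->
  \forall x \ae mu, D x ->
    [/\ `|lam x| <= 1, 0 < u x -> lam x = 1 & u x < 0 -> lam x = -1].
Proof.
move=> uy lamy sub.
have u2 := Lfuny_Lfun2_restrict mD fD uy.
have lam2 := Lfuny_Lfun2_restrict mD fD lamy.
have rat_ae (q : rat) : \forall x \ae mu, D x ->
    `|u x| + lam x * (ratr q - u x) - `|ratr q| <= 0.
  have iabs v : (v \_ D) \in Lfun mu +oo%E ->
      mu.-integrable D (EFin \o (fun x => `|v x|)).
    by move=> /Lfuny_restrict_integrable/integrable_norm.
  have il v : (v \_ D) \in Lfun mu +oo%E ->
      mu.-integrable D (EFin \o (fun x => lam x * (v x - u x))).
    move=> vy; apply: (Lfun2_restrictM mD lam2).
    exact: (Lfun2_restrictB mD (Lfuny_Lfun2_restrict mD fD vy) u2).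
  have iD v : (v \_ D) \in Lfun mu +oo%E -> mu.-integrable D
      (EFin \o (fun x => `|u x| + lam x * (v x - u x))).
    by move=> vy; exact: (integrableD mD (iabs _ uy) (il _ vy)).
  have iB v : (v \_ D) \in Lfun mu +oo%E -> mu.-integrable D
      (EFin \o (fun x => `|u x| + lam x * (v x - u x) - `|v x|)).
    by move=> vy; exact: (integrableB mD (iD _ vy) (iabs _ vy)).
  have cy : ((cst (ratr q) : T -> R) \_ D) \in Lfun mu +oo%E.
    apply: (@Lfuny_restrict _ _ _ _ _ mD _ `|ratr q|); first exact: measurable_cst.
    exact: nearW.
  apply: (ae_le0_Rintegral mD (iB _ cy)) => B mB BD /=.
  have sy := switch_Lfuny (ratr q) mB uy.
  rewrite -(@Rintegral_switch _ _ (fun x => `|u x| +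
    lam x * (switch B (ratr q) u x - u x) - `|switch B (ratr q) u x|) BD).
    rewrite RintegralB//; [|exact: iD|exact: iabs].
    rewrite RintegralD//; [|exact: iabs|exact: il].
    rewrite subr_le0; apply: sub; apply/Lfun1_restrictP => //.
    exact: Lfuny_restrict_integrable.
  by move=> x _; rewrite switchE; case: ifPn => // _; rewrite subrr mulr0 addr0 subrr.
apply: filterS (ae_forall_rat rat_ae) => x + Dx.
move=> H; have {}H q := H q Dx.
move: (u x) (lam x) H => {uy lamy sub u2 lam2 rat_ae u lam} u lam H.
have mid (a b : R) : a < b -> exists2 c, a < c < b &
    `|u| + lam * (c - u) - `|c| <= 0.
  by move=> /rat_in_itvoo[q]; rewrite in_itv => qab; exists (ratr q).
(* A rational with the sign of [u] makes both absolute values linear; taken above [u] it bounds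
   [lam] from above, taken below [u] from below. *)
have pos : 0 < u -> lam = 1.
  move=> u0; apply/eqP; rewrite eq_le; apply/andP; split.
    have [|c /andP[uc _]] := mid u (u + 1); first by rewrite ltrDl.
    rewrite !gtr0_norm//; last exact: lt_trans uc.
    by move=> ?; rewrite -(ler_pM2r (_ : 0 < c - u)) ?subr_gt0//; lra.
  have [c /andP[c0 cu]] := mid 0 u u0.
  rewrite !gtr0_norm// => ?.
  by rewrite -(ler_pM2r (_ : 0 < u - c)) ?subr_gt0//; lra.
have neg : u < 0 -> lam = -1.
  move=> u0; apply/eqP; rewrite eq_le; apply/andP; split.
    have [c /andP[c0 cu]] := mid u 0 u0.
    rewrite !ltr0_norm// => ?.
    by rewrite -(ler_pM2r (_ : 0 < c - u)) ?subr_gt0//; lra.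
  have [|c /andP[_ uc]] := mid (u - 1) u; first by rewrite gtrBl.
  rewrite !ltr0_norm//; last exact: lt_trans u0.
  by move=> ?; rewrite -(ler_pM2r (_ : 0 < u - c)) ?subr_gt0//; lra.
split=> //; have [/neg ->|/pos ->|u0] := ltgtP u 0; rewrite ?normrN ?normr1//.
(* At [u = 0] the rationals 1 and -1 give the two bounds on [lam]. *)
have := H 1; have := H (-1).
rewrite u0 rmorphN1 rmorph1 normrN normr1 normr0 => ? ?.
by rewrite ler_norml; apply/andP; split; lra.
Qed.

(** A switch to a rational strictly between the bounds stays admissible, so [g * (q - u) >= 0]
    almost everywhere for all such [q]. A [q] above or below [u] reveals the sign of [g]. *)
Lemma variational_inequality_ae (alpha beta : R) u g :
  (u \_ D) \in Lfun mu +oo%E -> (g \_ D) \in Lfun mu 2%:E ->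
  (\forall x \ae mu, D x -> alpha <= u x <= beta) ->
  (forall v, (v \_ D) \in Lfun mu +oo%E ->
    (\forall x \ae mu, D x -> alpha <= v x <= beta) ->
    0 <= \int[mu]_(x in D) (g x * (v x - u x))) ->
  \forall x \ae mu, D x ->
    [/\ alpha <= u x <= beta, u x < beta -> 0 <= g x & alpha < u x -> g x <= 0].
Proof.
move=> uy g2 uab vi.
have u2 := Lfuny_Lfun2_restrict mD fD uy.
have rat_ae (q : rat) : \forall x \ae mu, alpha < ratr q < beta -> D x ->
    - (g x * (ratr q - u x)) <= 0.
  (* The condition on [q] stays inside the statement, which is vacuous for the other rationals, so
     that the family is indexed by all of them. *)
  have [/andP[aq qb]|nq] := boolP (alpha < ratr q < beta); last exact: nearW.
  suff : \forall x \ae mu, D x -> - (g x * (ratr q - u x)) <= 0.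
    by apply: filterS => x + _.
  have cy : ((cst (ratr q) : T -> R) \_ D) \in Lfun mu +oo%E.
    apply: (@Lfuny_restrict _ _ _ _ _ mD _ `|ratr q|); first exact: measurable_cst.
    exact: nearW.
  have ig v : (v \_ D) \in Lfun mu +oo%E ->
      mu.-integrable D (EFin \o (fun x => g x * (v x - u x))).
    move=> vy; apply: (Lfun2_restrictM mD g2).
    exact: (Lfun2_restrictB mD (Lfuny_Lfun2_restrict mD fD vy) u2).
  have iN : mu.-integrable D (EFin \o (fun x => - (g x * (ratr q - u x)))).
    exact: (integrableN (ig _ cy)).
  apply: (ae_le0_Rintegral mD iN) => B mB BD.
  have sy := switch_Lfuny (ratr q) mB uy.
  rewrite -(@Rintegral_switch _ _ (fun x =>
    -1 * (g x * (switch B (ratr q) u x - u x))) BD).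
    rewrite RintegralZl//; last exact: ig.
    rewrite mulN1r oppr_le0; apply: vi => //.
    apply: filterS uab => x uab Dx; rewrite switchE; case: ifPn => _; last exact: uab.
    by rewrite !ltW.
  move=> x _; rewrite switchE mulN1r; case: ifPn => // _.
  by rewrite subrr mulr0 oppr0.
apply: filterS2 uab (ae_forall_rat rat_ae) => x uab H Dx.
have uabx := uab Dx; have {}H q qab := H q qab Dx.
move: (u x) (g x) uabx H => {uy g2 uab vi u2 rat_ae u g} u g /andP[au ub] H.
have mid (a b : R) : alpha <= a -> b <= beta -> a < b ->
    exists2 c, a < c < b & 0 <= g * (c - u).
  move=> aa bb /rat_in_itvoo[q]; rewrite in_itv/= => /andP[aq qb].
  exists (ratr q); first by rewrite aq qb.
  by rewrite -oppr_le0; apply: H; rewrite (le_lt_trans aa)//= (lt_le_trans qb).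
split; first by rewrite au.
- move=> ub'; have [c /andP[uc _]] := mid u beta au (lexx _) ub'.
  by rewrite pmulr_lge0// subr_gt0.
- move=> au'; have [c /andP[_ uc]] := mid alpha u (lexx _) ub au'.
  by rewrite nmulr_lge0// subr_lt0.
Qed.

End pointwise_conditions.

(** Scalar case analysis. With [t] the argument of the first projection, the gradient is
    [nu * (u - t)], so its sign conditions characterize the projection of [t]. The sign of [u] fixes
    [lam] and thereby the position of [p] relative to [-kappa] and [kappa]. *)
Lemma projection_formulas (R : realType) (nu kappa alpha beta u p lam : R) :
  0 < nu -> 0 <= kappa -> alpha < 0 -> 0 < beta ->
  [/\ `|lam| <= 1, 0 < u -> lam = 1 & u < 0 -> lam = -1] ->
  [/\ alpha <= u <= beta, u < beta -> 0 <= p + nu * u + kappa * lam &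
      alpha < u -> p + nu * u + kappa * lam <= 0] ->
  [/\ u = proj_itv alpha beta (- nu^-1 * (p + kappa * lam)),
      u = 0 <-> `|p| <= kappa &
      0 < kappa -> lam = proj_itv (-1) 1 (- kappa^-1 * p)].
Proof.
move=> nu0 k0 a0 b0 [lam1 lamp lamn] [/andP[au ub] Gb Ga].
have p_neg : 0 < u -> p < - kappa.
  move=> u0; have := Ga (lt_trans a0 u0); rewrite lamp//.
  by have := mulr_gt0 nu0 u0; lra.
have p_pos : u < 0 -> kappa < p.
  move=> u0; have nuu : nu * u < 0 by rewrite pmulr_rlt0.
  by have := Gb (lt_trans u0 b0); rewrite lamn//; lra.
(* As [alpha < 0 < beta], no bound is active at 0 and both sign conditions apply. *)
have p_zero : u = 0 -> p = - (kappa * lam).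
  by move=> u0; move: Gb Ga; rewrite u0 mulr0 => /(_ b0) ? /(_ a0) ?; lra.
split.
- set t := - nu^-1 * (p + kappa * lam).
  have GE : p + nu * u + kappa * lam = nu * (u - t).
    by rewrite /t mulrBr mulrA mulrN mulfV ?gt_eqF//; ring.
  rewrite GE pmulr_rge0// pmulr_rle0// subr_ge0 subr_le0 in Gb Ga.
  rewrite /proj_itv; have [aleu|ult] := ltP alpha u.
    have ut := Ga aleu; have at_ := lt_le_trans aleu ut.
    rewrite max_r ?ltW//; have [ubeta|ubeta] := ltP u beta.
      have tu := Gb ubeta; have <- : u = t by apply/eqP; rewrite eq_le ut tu.
      by rewrite min_r.
    by rewrite min_l ?(le_trans ubeta)//; apply/eqP; rewrite eq_le ub.
  have uE : u = alpha by apply/eqP; rewrite eq_le ult.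
  have ta : t <= alpha by rewrite -uE; apply: Gb; rewrite uE (lt_trans a0).
  by rewrite max_l// min_r// ltW// (lt_trans a0).
- split=> [/p_zero ->|].
    by rewrite normrN normrM (ger0_norm k0) -[leRHS]mulr1 ler_wpM2l.
  rewrite ler_norml => /andP[pk kp]; apply/eqP; rewrite eq_le !leNgt.
  apply/andP; split; apply/negP; first by move=> /p_neg; rewrite ltNge pk.
  by move=> /p_pos; rewrite ltNge kp.
- move=> kp; rewrite /proj_itv; have [u0|u0|u0] := ltgtP u 0.
  + rewrite lamn// max_l; first by rewrite min_r; lra.
    by rewrite mulNr lerN2 mulrC ler_pdivlMr// mul1r ltW// p_pos.
  + rewrite lamp// max_r.
      by rewrite min_l// mulNr -mulrN mulrC ler_pdivlMr// mul1r lerNr ltW// p_neg.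
    rewrite mulNr lerN2 mulrC ler_pdivrMr// mul1r.
    by have := p_neg u0; lra.
  + rewrite p_zero// mulNr mulrN opprK mulKf ?gt_eqF//.
    by move: lam1; rewrite ler_norml => /andP[l1 l2]; rewrite max_r// min_r.
Qed.

(** * The control problem *)

(** Points of the open set [A] are interior to its closure, where relative continuity is ordinary
    continuity. *)
Lemma open_preimage_within_closure {T U : topologicalType} (A : set T)
    (f : T -> U) (V : set U) :
  open A -> open V -> {within closure A, continuous f} ->
  open (A `&` f @^-1` V).
Proof.
move=> oA oV /subspace_continuousP cf; rewrite openE => x [Ax Vfx].
have /(cf x (subset_closure Ax)) : nbhs (f x) V by exact: open_nbhs_nbhs.
rewrite /= /within/= nbhs_simpl/= => fV.
have nA : nbhs x A by exact: open_nbhs_nbhs.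
rewrite /interior; near=> z; have Az : A z by near: z.
split => //; have : closure A z -> V (f z) by near: z; exact: fV.
by apply; exact: subset_closure.
Unshelve. all: by end_near. Qed.

Section control_problem.
Context {R : realType} {n : nat}.
Local Notation E := 'rV[R]_n.
Local Notation leb := (@lebesgue_rV R n).
Variables (Omega : set E) (a : 'I_n -> 'I_n -> E -> R) (a0 : E -> R) (f : R -> R).

(** Both outcomes of [xget] are continuous: a state by definition, the default as a constant. *)
Lemma control_to_state_continuous (r : R) (u : E -> R) :
  {within closure Omega, continuous (control_to_state Omega a a0 f r u)}.
Proof.
rewrite /control_to_state; case: xgetP => [y _ []//|_].
by apply: continuous_subspaceT => x; exact: cst_continuous.
Qed.

(** The kinks form a finite, hence closed set, so the complement of this set in [Omega] is open. *)
Lemma measurable_preimage_kinks (K : nat) (tau : nat -> \bar R) (y : E -> R) :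
  open Omega -> {within closure Omega, continuous y} ->
  measurable (Omega `&` [set x | kinks K tau (y x)]).
Proof.
move=> oO cy; rewrite (_ : _ `&` _ = Omega `\` (Omega `&` y @^-1` (~` kinks K tau))).
  apply: measurableD; first exact: open_rV_measurable.
  apply: open_rV_measurable; apply: open_preimage_within_closure => //.
  have := @hausdorff_accessible _ (@norm_hausdorff _ R).
  move=> /accessible_finite_set_closed/(_ _ (finite_kinks K tau)).
  exact: closed_openC.
apply/seteqP; split => x [Ox] /=; first by move=> kx; split => // -[].
by move=> nx; split => //; apply: contrapT => nk; exact: nx.
Qed.

End control_problem.

Theorem corollary2 (R : realType) (n : nat)
  (* N = n.+1 >= 1 *)
  (Omega : set 'rV[R]_n.+1) (hOmega : bounded_lipschitz_domain Omega)
  (nu kappa alpha beta : R)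
  (hnu : 0 < nu) (hkappa : 0 <= kappa) (halpha : alpha < 0) (hbeta : 0 < beta)
  (a : 'I_n.+1 -> 'I_n.+1 -> 'rV[R]_n.+1 -> R) (a0 : 'rV[R]_n.+1 -> R)
  (hA : elliptic_coefficients Omega a a0)
  (K : nat) (tau : nat -> \bar R) (f_ : nat -> R -> R) (f : R -> R)
  (hf : piecewise_C2 K tau f_ f)
  (r : R) (hrN : n.+1%:R / 2 < r) (hr2 : 2 <= r)
  (L : 'rV[R]_n.+1 -> R -> R) (hL : admissible_integrand Omega L)
  (u : 'rV[R]_n.+1 -> R)
  (hu : local_minimizer Omega a a0 f r nu kappa alpha beta L u) :
  (forall p lam chi : 'rV[R]_n.+1 -> R,
     first_order_system Omega a a0 f r nu kappa alpha beta L u p lam chi ->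
     \forall x \ae lebesgue_rV n.+1, Omega x ->
       [/\ u x = proj_itv alpha beta (- nu^-1 * (p x + kappa * lam x)),
           u x = 0 <-> `|p x| <= kappa &
           0 < kappa -> lam x = proj_itv (-1) 1 (- kappa^-1 * p x)]) /\
  (lebesgue_rV n.+1 (Omega `&` [set x | kinks K tau (control_to_state Omega a a0 f r u x)]) = 0%E ->
   forall p1 lam1 chi1 p2 lam2 chi2 : 'rV[R]_n.+1 -> R,
     first_order_system Omega a a0 f r nu kappa alpha beta L u p1 lam1 chi1 ->
     first_order_system Omega a a0 f r nu kappa alpha beta L u p2 lam2 chi2 ->
     (forall x, closure Omega x -> p1 x = p2 x) /\
     (0 < kappa ->
      \forall x \ae lebesgue_rV n.+1, Omega x -> lam1 x = lam2 x)).
Proof.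
have [oO _ _ bO _] := hOmega.
have mO : measurable Omega by exact: open_rV_measurable.
have fO : (lebesgue_rV n.+1 Omega < +oo)%E by exact: bounded_lebesgue_rV_lty.
have [[uy uab] _] := hu.
have part1 : forall p lam chi : 'rV[R]_n.+1 -> R,
     first_order_system Omega a a0 f r nu kappa alpha beta L u p lam chi ->
     \forall x \ae lebesgue_rV n.+1, Omega x ->
       [/\ u x = proj_itv alpha beta (- nu^-1 * (p x + kappa * lam x)),
           u x = 0 <-> `|p x| <= kappa &
           0 < kappa -> lam x = proj_itv (-1) 1 (- kappa^-1 * p x)].
  move=> p lam chi [[_ [dp [[p2 _ _] _] _]] [lamy lamsub] _ _ vi].
  (* [p] is in H^1, while [u] and [lam] are bounded on a set of finite measure. *)
  have g2 : Lp Omega 2%:E (fun x => p x + nu * u x + kappa * lam x).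
    apply: (Lfun2_restrictD mO); last first.
      exact: (Lfun2_restrictZ mO kappa (Lfuny_Lfun2_restrict mO fO lamy)).
    apply: (Lfun2_restrictD mO p2).
    exact: (Lfun2_restrictZ mO nu (Lfuny_Lfun2_restrict mO fO uy)).
  have lam_ae := subdifferential_l1_ae mO fO uy lamy lamsub.
  have vi_ae := variational_inequality_ae mO fO uy g2 uab
    (fun v vy vab => vi v (conj vy vab)).
  apply: filterS2 lam_ae vi_ae => x lamx vix Ox.
  exact: projection_formulas (lamx Ox) (vix Ox).
split=> // kinks0 p1 lam1 chi1 p2 lam2 chi2 S1 S2.
have [[cp1 w1] _ chi1y chi1C _] := S1; have [[cp2 w2] _ chi2y chi2C _] := S2.
have nkinks : \forall x \ae lebesgue_rV n.+1, Omega x ->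
    ~ kinks K tau (control_to_state Omega a a0 f r u x).
  exists (Omega `&` [set x | kinks K tau (control_to_state Omega a a0 f r u x)]).
  split => //; last by move=> x /= /not_implyP[Ox /contrapT].
  apply: measurable_preimage_kinks => //; exact: control_to_state_continuous.
have chi12 : \forall x \ae lebesgue_rV n.+1, Omega x -> 0 <= chi1 x /\ chi1 x = chi2 x.
  apply: filterS3 nkinks chi1C chi2C => x nk c1 c2 Ox.
  have [g [gC2 hg fg]] := piecewise_C2_near hf (nk Ox).
  have [chi1_ge0 chi1E] := clarke_subdifferential_C2 gC2 hg fg (c1 Ox).
  have [_ chi2E] := clarke_subdifferential_C2 gC2 hg fg (c2 Ox).
  by split; rewrite // chi1E chi2E.
(* The adjoint equation has the transposed coefficients, and [ord0] is available because the
   dimension is positive. *)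
have p12 := weak_solution_ae_eq oO bO ord0 (elliptic_coefficients_tr hA)
  chi1y chi2y chi12 w1 w2.
split=> [x cx|kappa0]; first exact: (ae_eq_closure_continuous oO cp1 cp2 p12 cx).
(* For [kappa > 0] the projection formula expresses each multiplier through its adjoint state. *)
apply: filterS3 p12 (part1 _ _ _ S1) (part1 _ _ _ S2) => x p12x H1 H2 Ox.
have [_ _ /(_ kappa0) ->] := H1 Ox; have [_ _ /(_ kappa0) ->] := H2 Ox.
by rewrite p12x.
Qed.
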